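(* Let $n\ge 1$, $d\ge 1$ and $g$ be integers with $0<g\le 8$ and $d\ge \max(n,2g-2)$. Let $M^n_d$ be the space of nondegenerate morphisms $f:\mathbb{P}^1\to\mathbb{P}^n$ of degree $d$ over $\mathbb{C}$, and let $M^n_{d,g}\subset M^n_d$ be the subvariety of those morphisms whose image curve $f(\mathbb{P}^1)$ has arithmetic genus $g$. Let $\mathcal{V}\subset M^n_{d,g}$ be the subvariety consisting of those morphisms whose image has at worst unibranch singularities (i.e. every singular point of $f(\mathbb{P}^1)$ has a single branch). Then \[ \operatorname{cod}(\mathcal{V},M^n_d)\ \ge\ (n-2)g . \]
   Context: Work over $\mathbb{C}$. A morphism $f=(f_0,\dots,f_n):\mathbb{P}^1\to\mathbb{P}^n$ of degree $d$ is given by homogeneous polynomials $f_i=a_{i,0}t^d+a_{i,1}t^{d-1}u+\dots+a_{i,d}u^d$ of degree $d$ in homogeneous coordinates $t,u$ on $\mathbb{P}^1$, and is identified with its tuple of coefficients $(a_{i,j})$; nondegenerate means the image is not contained in a hyperplane. Thus $M^n_d$ is a space of frames over the Grassmannian of $(n+1)$-dimensional subspaces of $H^0(\mathcal{O}_{\mathbb{P}^1}(d))$. The arithmetic genus of the rational image curve $C=f(\mathbb{P}^1)$ is $g=\sum_{P\in C}\delta_P$, where $\delta_P$ is the delta-invariant of $C$ at $P$; for a unibranch singular point $P$ with value semigroup $\mathrm{S}\subset\mathbb{N}$ (the set of valuations $v(\phi(h))$ of elements $h$ of the local ring under the normalization map to $\mathbb{C}[[t]]$), $\delta_P=\#(\mathbb{N}\setminus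 \mathrm{S})$. *)

(* Defs.v *)
From HB Require Import structures.
From mathcomp Require Import all_boot all_order all_algebra.
From mathcomp Require Import complex.
From mathcomp Require Import Rstruct.
From mathcomp.multinomials Require Import mpoly.
From Stdlib Require Reals.

Set Implicit Arguments.
Unset Strict Implicit.
Unset Printing Implicit Defensive.
Import Order.TTheory GRing.Theory Num.Theory.
Local Open Scope ring_scope.

Definition C : Type := complex Rdefinitions.R.

Definition bform (m : nat) (c : 'rV[C]_m.+1) (t u : C) : C :=
  \sum_(j < m.+1) c 0 j * t ^+ (m - j) * u ^+ j.

Definition p1pt (q : C * C) : Prop := q <> (0, 0).
Definition p1eq (q q' : C * C) : Prop := q.1 * q'.2 = q'.1 * q.2.

Definition propv (k : nat) (v w : 'I_k -> C) : Prop :=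
  forall i j, v i * w j = v j * w i.

(** A morphism P^1 -> P^n of degree m given by the rows of [A]:
    the forms have no common zero on P^1. *)
Definition base_point_free (n m : nat) (A : 'M[C]_(n.+1, m.+1)) : Prop :=
  forall t u : C, p1pt (t, u) -> exists i, bform (row i A) t u != 0.

(** Nondegenerate: image not in a hyperplane, i.e. the forms are linearly
    independent, i.e. the coefficient matrix has full row rank. *)
Definition nondegenerate (n m : nat) (A : 'M[C]_(n.+1, m.+1)) : Prop :=
  row_free A.

Definition Mnd (n d : nat) (A : 'M[C]_(n.+1, d.+1)) : Prop :=
  base_point_free A /\ nondegenerate A.

Definition is_composite (n d e k : nat) (A : 'M[C]_(n.+1, d.+1))
    (H : 'M[C]_(n.+1, e.+1)) (P : 'M[C]_(2, k.+1)) : Prop :=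
  forall (i : 'I_n.+1) (t u : C),
    bform (row i A) t u =
    bform (row i H) (bform (row 0 P) t u) (bform (row 1 P) t u).

(** Local expansion at q = (a:b) in P^1: substitute (t,u) = (a + s c, b + s e)
    where (c:e) is a fixed point distinct from q; the result is a polynomial
    in the local parameter s. *)
Definition cpl (q : C * C) : C * C := if q.1 != 0 then (0, 1) else (1, 0).

Definition locform (m : nat) (c : 'rV[C]_m.+1) (q : C * C) : {poly C} :=
  \sum_(j < m.+1) (c 0 j)%:P * (q.1%:P + (cpl q).1 *: 'X) ^+ (m - j)
                             * (q.2%:P + (cpl q).2 *: 'X) ^+ j.

Definition loc_comp (n e : nat) (G : {mpoly C[n.+1]}) (H : 'M[C]_(n.+1, e.+1))
    (q : C * C) : {poly C} :=
  (map_mpoly (fun x : C => x%:P) G).@[fun i => locform (row i H) q].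

Definition ord0 (p : {poly C}) : nat := find (fun x : C => x != 0) p.

(** Value semigroup of the image curve at the point h(q), when h is the
    normalization: S = { v(phi(G/L^k)) } = { ord_q (G o h) : G homogeneous,
    G o h <> 0 }. *)
Definition value_semigroup (n e : nat) (H : 'M[C]_(n.+1, e.+1)) (q : C * C)
    (v : nat) : Prop :=
  exists (k : nat) (G : {mpoly C[n.+1]}),
    G \is k.-homog /\ loc_comp G H q != 0 /\ ord0 (loc_comp G H q) = v.

Definition delta_is (n e : nat) (H : 'M[C]_(n.+1, e.+1)) (q : C * C)
    (c : nat) : Prop :=
  exists s : seq nat, uniq s /\ size s = c /\
    (forall v, v \in s <-> ~ value_semigroup H q v).

Definition injective_P1 (n e : nat) (H : 'M[C]_(n.+1, e.+1)) : Prop :=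
  forall q q' : C * C, p1pt q -> p1pt q' ->
    propv (fun i => bform (row i H) q.1 q.2) (fun i => bform (row i H) q'.1 q'.2) ->
    p1eq q q'.

Definition genus_sum_delta (n e : nat) (H : 'M[C]_(n.+1, e.+1)) (g : nat) : Prop :=
  exists (qs : seq (C * C)) (cs : seq nat),
    size qs = size cs /\ sumn cs = g /\
    (forall i : nat, is_true (leq i.+1 (size qs)) -> p1pt (nth (0,0) qs i)) /\
    (forall i j : nat, is_true (leq i.+1 (size qs)) -> is_true (leq j.+1 (size qs)) ->
       p1eq (nth (0,0) qs i) (nth (0,0) qs j) -> i = j) /\
    (forall i : nat, is_true (leq i.+1 (size qs)) -> delta_is H (nth (0,0) qs i) (nth 0%nat cs i)) /\
    (forall q, p1pt q -> (forall i : nat, is_true (leq i.+1 (size qs)) -> ~ p1eq q (nth (0,0) qs i)) ->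
       delta_is H q 0).

(** The locus V: f in M^n_d whose image has only unibranch singularities and
    arithmetic genus g.  Writing f = h o pi with h : P^1 -> C the normalization
    (Lueroth), "unibranch" means h is injective, and the genus is the sum of
    the delta invariants computed through h. *)
Definition Vlocus (n d g : nat) (A : 'M[C]_(n.+1, d.+1)) : Prop :=
  Mnd A /\
  exists (e k : nat) (H : 'M[C]_(n.+1, e.+1)) (P : 'M[C]_(2, k.+1)),
    (0 < e)%nat /\ (0 < k)%nat /\ (e * k = d)%nat /\
    base_point_free H /\ base_point_free P /\
    is_composite A H P /\ injective_P1 H /\ genus_sum_delta H g.

(** dim S <= D for S a subset of C^N: every family of more than D coordinate
    functions is algebraically dependent on S (equivalently on its Zariski
    closure).  This handles S empty (dimension -oo). *)
Definition dim_le (N : nat) (S : 'rV[C]_N -> Prop) (D : int) : Prop :=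
  forall I : {set 'I_N}, (D < (#|I|)%:Z)%R ->
    exists p : {mpoly C[N]}, p != 0 /\
      (forall m, m \in msupp p -> forall i, i \notin I -> m i = 0%nat) /\
      (forall x, S x -> p.@[fun i => x 0 i] = 0).

Definition coord_set (n d : nat) (S : 'M[C]_(n.+1, d.+1) -> Prop) :
    'rV[C]_(n.+1 * d.+1) -> Prop :=
  fun x => exists A, S A /\ mxvec A = x.

(* Main.v *)
(** For [n <= 2] there is nothing to prove.  A multiple cover of degree [k >= 2] is a polynomial
    function of the [(n+1)(e+1) + 2(k+1)] coefficients of the two factors, and these are few enough.
    Otherwise the morphism [f] is the normalisation of its image up to a coordinate change, and one
    counts parameters.  Fix the singular points [q_i], their value semigroups [S_i] with [delta_i]
    gaps, and a combination [L] of the forms that vanishes at no [q_i].  Modulo a power [c_i] of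
    the local parameter, the local ring at [q_i] has a basis indexed by the elements of [S_i]
    below [c_i], made of products of elements attached to the generators of [S_i]; reducing the
    latter leaves one parameter for each pair (generator, larger gap), the effective weight.  With
    [\sum_i c_i = d + 1], Hermite interpolation recovers each form from its jets, hence from its
    coordinates in these bases, [d + 1 - g] of them if [c_i >= 2 delta_i].  All together
    [(d+1) + \sum_i (1 + weight_i) + n (d + 1 - g)] parameters suffice, and for [delta <= 8] an
    enumeration of semigroups gives [1 + weight <= 2 delta].  When [d = 2g - 2] one of the [c_i]
    must be [2 delta_i - 1]; if this loses a gap, then the independence of the [n + 1] forms gives
    [n < g], and the enumeration gives [\sum_i (1 + weight_i) <= g], which compensates. *)

Require Import Defs.
From HB Require Import structures.
From mathcomp Require Import all_boot all_order all_algebra.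
From mathcomp.multinomials Require Import mpoly.
From mathcomp Require Import complex Rstruct zify ring.
From Stdlib Require Import Classical.

Set Implicit Arguments.
Unset Strict Implicit.
Unset Printing Implicit Defensive.
Import Order.TTheory GRing.Theory Num.Theory.
Local Open Scope ring_scope.

(** * Dimension of a rationally parametrised set *)

Section PolynomialFunctions.
Context {F : fieldType} {T : finType}.
Implicit Types (f g : (T -> F) -> F) (y : T -> F).

(** The bound [K] is on the exponent of each variable separately, so that the monomials in the
    variables of [J] number [K.+1 ^ #|J|]. *)
Definition polyfun_deg (K : nat) f : Prop :=
  exists2 s : seq (F * (T -> nat)),
    forall p, List.In p s -> forall t, (p.2 t <= K)%N &
    forall y, f y = \sum_(p <- s) p.1 * \prod_t y t ^+ p.2 t.

Definition polyfun f : Prop := exists K, polyfun_deg K f.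

Lemma polyfun_degW K K' f : (K <= K')%N -> polyfun_deg K f -> polyfun_deg K' f.
Proof.
move=> leK [s hs Hf]; exists s => // p ps t.
exact: leq_trans (hs p ps t) leK.
Qed.

Lemma polyfun_deg_const K c : polyfun_deg K (fun=> c).
Proof.
exists [:: (c, fun=> 0%N)]; first by move=> p [<-|//] t.
move=> y; rewrite big_seq1 /= big1 ?mulr1 // => t _; exact: expr0.
Qed.

Lemma polyfun_degM K L f g :
  polyfun_deg K f -> polyfun_deg L g -> polyfun_deg (K + L) (fun y => f y * g y).
Proof.
case=> s hs Hf [s' hs' Hg].
exists (flatten [seq [seq (p.1 * q.1, fun t => (p.2 t + q.2 t)%N) | q <- s'] | p <- s]).
  elim: s hs {Hf} => [|p s IH] hs q //=.
  rewrite List.in_app_iff => -[|]; last by apply: IH => r rs; apply: hs; right.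
  elim: s' hs' {Hg IH} => [|p' s' IH] hs' //= [<- t|]; last first.
    by apply: IH => r rs; apply: hs'; right.
  by apply: leq_add; [apply: hs; left|apply: hs'; left].
move=> y; rewrite Hf Hg big_flatten big_map mulr_suml; apply: eq_bigr => p _.
rewrite big_map mulr_sumr; apply: eq_bigr => q _ /=.
rewrite mulrACA -big_split; congr (_ * _); apply: eq_bigr => t _; exact: esym (exprD _ _ _).
Qed.

Lemma polyfun_degX K f n :
  polyfun_deg K f -> polyfun_deg (n * K) (fun y => f y ^+ n).
Proof.
move=> hf; elim: n => [|n IH].
  have [s hs Hs] := polyfun_deg_const 0 1.
  by exists s => // y; rewrite expr0 -Hs.
have [s hs Hs] := polyfun_degM hf IH.
by exists s => [p ps t|y]; rewrite ?mulSn ?hs // exprS Hs.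
Qed.

Lemma polyfun_deg_prod (J : finType) (P : pred J) (K : J -> nat) (f : J -> (T -> F) -> F) :
  (forall j, polyfun_deg (K j) (f j)) ->
  polyfun_deg (\sum_(j | P j) K j) (fun y => \prod_(j | P j) f j y).
Proof.
move=> hf; rewrite -big_filter.
set r := filter _ _.
have [s hs Hs] : polyfun_deg (\sum_(j <- r) K j) (fun y => \prod_(j <- r) f j y).
  elim: r => [|j r IH].
    have [s hs Hs] := polyfun_deg_const 0 1.
    by exists s => [p ps t|y]; rewrite big_nil ?hs // -Hs.
  have [s hs Hs] := polyfun_degM (hf j) IH.
  by exists s => [p ps t|y]; rewrite big_cons ?hs // -Hs.
by exists s => // y; rewrite -Hs -big_filter.
Qed.

Lemma polyfun_ext f g : f =1 g -> polyfun f -> polyfun g.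
Proof. by move=> e [K [s hs Hf]]; exists K, s => // y; rewrite -e. Qed.

Lemma polyfun_const c : polyfun (fun=> c).
Proof. by exists 0%N; apply: polyfun_deg_const. Qed.

Lemma polyfun_var t : polyfun (fun y => y t).
Proof.
exists 1%N, [:: (1, fun u => (u == t) : nat)].
  by move=> p [<-|//] u /=; case: eqP.
move=> y; rewrite big_seq1 /= mul1r (bigD1 t) //= eqxx big1 ?mulr1 //.
by move=> u /negPf ->.
Qed.

Lemma polyfunD f g : polyfun f -> polyfun g -> polyfun (fun y => f y + g y).
Proof.
case=> K [s hs Hf] [K' [s' hs' Hg]]; exists (K + K')%N, (s ++ s').
  move=> p /List.in_app_iff [/hs|/hs'] h t; have := h t; lia.
by move=> y; rewrite Hf Hg big_cat.
Qed.

Lemma polyfunM f g : polyfun f -> polyfun g -> polyfun (fun y => f y * g y).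
Proof. by move=> [K hf] [L hg]; exists (K + L)%N; apply: polyfun_degM. Qed.

Lemma polyfunN f : polyfun f -> polyfun (fun y => - f y).
Proof.
move=> hf; apply: polyfun_ext (polyfunM (polyfun_const (-1)) hf).
by move=> y; rewrite mulN1r.
Qed.

Lemma polyfun_sum (J : Type) (r : seq J) (P : pred J) (f : J -> (T -> F) -> F) :
  (forall j, P j -> polyfun (f j)) -> polyfun (fun y => \sum_(j <- r | P j) f j y).
Proof.
move=> hf; elim: r => [|j r IH].
  by apply: polyfun_ext (polyfun_const 0) => y; rewrite big_nil.
have [Pj|nPj] := boolP (P j).
  by apply: polyfun_ext (polyfunD (hf j Pj) IH) => y; rewrite big_cons Pj.
by apply: polyfun_ext IH => y; rewrite big_cons (negPf nPj).
Qed.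

Lemma polyfun_prod (J : Type) (r : seq J) (P : pred J) (f : J -> (T -> F) -> F) :
  (forall j, P j -> polyfun (f j)) -> polyfun (fun y => \prod_(j <- r | P j) f j y).
Proof.
move=> hf; elim: r => [|j r IH].
  by apply: polyfun_ext (polyfun_const 1) => y; rewrite big_nil.
have [Pj|nPj] := boolP (P j).
  by apply: polyfun_ext (polyfunM (hf j Pj) IH) => y; rewrite big_cons Pj.
by apply: polyfun_ext IH => y; rewrite big_cons (negPf nPj).
Qed.

Lemma polyfun_det n (A : (T -> F) -> 'M[F]_n) :
  (forall i j, polyfun (fun y => A y i j)) -> polyfun (fun y => \det (A y)).
Proof.
move=> hA; apply: polyfun_sum => s _; apply: polyfunM; first exact: polyfun_const.
by apply: polyfun_prod => i _.
Qed.

Lemma polyfun_adj n (A : (T -> F) -> 'M[F]_n) i j :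
  (forall i j, polyfun (fun y => A y i j)) -> polyfun (fun y => (\adj (A y)) i j).
Proof.
move=> hA; apply: (@polyfun_ext (fun y => cofactor (A y) j i)).
  by move=> y; rewrite mxE.
apply: polyfunM; first exact: polyfun_const.
apply: polyfun_det => k l.
by apply: polyfun_ext (hA (lift j k) (lift i l)) => y; rewrite !mxE.
Qed.

(* On points supported on [J] only the monomials supported on [J] matter. *)
Lemma polyfun_deg_coef (J : {set T}) K f : polyfun_deg K f ->
  exists c : {ffun T -> 'I_K.+1} -> F, forall y, (forall t, t \notin J -> y t = 0) ->
    f y = \sum_(a in pffun_on 0 (mem J) predT) c a * \prod_t y t ^+ a t.
Proof.
case=> s hs Hf.
exists (fun a => \sum_(p <- s | [ffun t => inord (p.2 t)] == a) p.1) => y hy.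
rewrite Hf; under [RHS]eq_bigr do rewrite mulr_suml.
rewrite (exchange_big_dep predT) //=.
elim: s hs {Hf} => [|p s IH] hs; first by rewrite !big_nil.
rewrite !big_cons IH; last by move=> q qs; apply: hs; right.
congr (_ + _).
have hp t : (p.2 t <= K)%N by apply: hs; left.
set a0 := [ffun t => _].
have Ea : \prod_t y t ^+ p.2 t = \prod_t y t ^+ a0 t.
  by apply: eq_bigr => t _; rewrite ffunE inordK // ltnS.
rewrite Ea; have [aJ|naJ] := boolP (a0 \in pffun_on 0 (mem J) predT).
  rewrite (bigD1 a0) /=; last by rewrite aJ eqxx.
  by rewrite [X in _ + X]big1 ?addr0 // => a /andP[/andP[_ /eqP ->]]; rewrite eqxx.
rewrite [RHS]big1; last first.
  by move=> a /andP[aJ /eqP ea]; rewrite ea aJ in naJ.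
suff -> : \prod_t y t ^+ a0 t = 0 by rewrite mulr0.
have [t tJ at0] : exists2 t, t \notin J & a0 t != 0.
  apply: NNPP => H; case/negP: naJ; apply/pffun_onP; split=> //.
  apply/subsetP => t; apply: contraTT => tJ; rewrite inE negbK.
  by apply/negPn/negP => at0; apply: H; exists t.
have {}at0 : (a0 t : nat) != 0%N by [].
by rewrite (bigD1 t) //= hy // expr0n (negPf at0) mul0r.
Qed.

End PolynomialFunctions.

(** A matrix with more rows than columns has a nonzero left kernel. Rows will be monomials in the
    coordinates, columns monomials in the parameters, so a kernel vector is an algebraic
    relation. *)
Lemma exists_left_kernel (F : fieldType) (R S : finType) (A : {set R}) (B : {set S})
    (c : R -> S -> F) : (#|B| < #|A|)%N ->
  exists2 v : R -> F, exists2 a, a \in A & v a != 0 &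
    forall b, b \in B -> \sum_(a in A) v a * c a b = 0.
Proof.
move=> ltBA; pose M := \matrix_(i < #|A|, j < #|B|) c (enum_val i) (enum_val j).
have : kermx M != 0.
  rewrite kermx_eq0 -row_leq_rank -ltnNge; exact: leq_ltn_trans (rank_leq_col M) ltBA.
case/rowV0Pn => u /sub_kermxP uM /rV0Pn[i0 ui0].
have a0A := enum_valP i0.
exists (fun a => u 0 (enum_rank_in a0A a)).
  by exists (enum_val i0) => //; rewrite enum_valK_in.
move=> b bB; have := congr1 (fun w : 'rV_ _ => w 0 (enum_rank_in bB b)) uM.
rewrite !mxE => E; rewrite -[RHS]E (reindex_onto (enum_val (A := mem A)) (enum_rank_in a0A)) /=.
  apply: eq_big => [i|i _]; first by rewrite enum_valP enum_valK_in eqxx.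
  by rewrite enum_valK_in mxE enum_rankK_in.
by move=> a aA; rewrite enum_rankK_in.
Qed.

(** For [r = (N K + 1) ^ M], the bound [N r K + 1 <= (N K + 1) (r + 1)] makes the left side at most
    [r (r + 1) ^ M], which is less than [(r + 1) ^ N]. *)
Lemma exists_expn_gt (N M K : nat) : (M < N)%N ->
  exists r, ((N * r * K).+1 ^ M < r.+1 ^ N)%N.
Proof.
move=> ltMN; exists ((N * K).+1 ^ M)%N; set r := ((N * K).+1 ^ M)%N.
apply: (@leq_trans (r.+1 ^ M.+1)); last by rewrite leq_pexp2l.
rewrite expnS; apply: (@leq_ltn_trans (r * r.+1 ^ M)%N).
  rewrite {1}/r -expnMn; case: M {ltMN} @r => [//|M] r; rewrite leq_exp2r //.
  rewrite mulSn mulnS; have : (N * r * K = N * K * r)%N by rewrite mulnAC.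
  move=> ->; lia.
by rewrite ltn_mul2r ltnSn andbT expn_gt0.
Qed.

(* The monomials of degree at most [r] in each of more than [#|J|] coordinates outnumber
   the monomials in the parameters that can occur in them. *)
Lemma dim_le_param (N : nat) (V : 'rV[C]_N -> Prop) (D : int) (T : finType) (J : {set T})
    (h : (T -> C) -> C) (f : 'I_N -> (T -> C) -> C) :
  (#|J|)%:Z <= D -> polyfun h -> (forall i, polyfun (f i)) ->
  (forall x, V x -> exists y : T -> C, [/\ forall t, t \notin J -> y t = 0, h y != 0 &
     forall i, h y * x 0 i = f i y]) ->
  dim_le V D.
Proof.
move=> leJD [K0 hK0] hf hV I ltDI.
have ltJI : (#|J| < #|I|)%N by lia.
have [K [hh hfK]] : exists K, polyfun_deg K h /\ forall i, polyfun_deg K (f i).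
  have [k hk] := fin_all_exists hf.
  exists (K0 + \sum_i k i)%N; split; first by apply: polyfun_degW hK0; rewrite leq_addr.
  move=> i; apply: polyfun_degW (hk i).
  by rewrite (bigD1 i) //= addnCA leq_addr.
have [r hr] := exists_expn_gt (K) ltJI.
pose A := [set a : {ffun 'I_N -> 'I_r.+1} | a \in pffun_on 0 (mem I) predT].
(* The coordinates are quotients [f i / h]. The powers of [h] clear denominators uniformly: [W a] is
   [h ^ (r * #|I|)] times the monomial with exponents [a]. *)
pose W (a : {ffun 'I_N -> 'I_r.+1}) (y : T -> C) :=
  \prod_(i in I) (f i y ^+ a i * h y ^+ (r - a i)).
have HW a : polyfun_deg (#|I| * r * K) (W a).
  have [s hs Hs] : polyfun_deg (\sum_(i in I) (a i * K + (r - a i) * K)) (W a).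
    by apply: polyfun_deg_prod => i; apply: polyfun_degM; apply: polyfun_degX.
  exists s => // p ps t; apply: leq_trans (hs p ps t) _.
  under eq_bigr do rewrite -mulnDl subnKC ?leq_ord //.
  by rewrite sum_nat_const mulnA.
have /fin_all_exists[c hc] := fun a => polyfun_deg_coef J (HW a).
pose B := [set b : {ffun T -> 'I_(#|I| * r * K).+1} | b \in pffun_on 0 (mem J) predT].
have cardA : #|A| = (r.+1 ^ #|I|)%N by rewrite cardsE card_pffun_on card_ord.
have cardB : #|B| = ((#|I| * r * K).+1 ^ #|J|)%N by rewrite cardsE card_pffun_on card_ord.
have [|v [a0 a0A va0] hv] := @exists_left_kernel _ _ _ A B c; first by rewrite cardA cardB.
pose mn (a : {ffun 'I_N -> 'I_r.+1}) : 'X_{1..N} := [multinom (a i : nat) | i < N].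
have mn_inj : injective mn.
  move=> a b /mnmP e; apply/ffunP => i; apply: val_inj; move: (e i); by rewrite !mnmE.
exists (\sum_(a in A) v a *: 'X_[mn a]); split; [|split].
- apply/eqP => /(congr1 (mcoeff (mn a0))); rewrite mcoeff0 raddf_sum /= => /eqP.
  rewrite (bigD1 a0) //= mcoeffZ mcoeffX eqxx mulr1 big1 ?addr0 ?(negPf va0) //.
  move=> a /andP[_ ne]; rewrite mcoeffZ mcoeffX.
  by case: eqP => [/mn_inj e|_]; [rewrite e eqxx in ne|rewrite mulr0].
- move=> m; rewrite mcoeff_msupp raddf_sum /= => nz i iI.
  have [a aA] : exists2 a, a \in A & mn a = m.
    apply: NNPP => H; move/eqP: nz; apply; apply: big1 => a aA.
    rewrite mcoeffZ mcoeffX; case: eqP => [e|]; rewrite ?mulr0 //.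
    by case: H; exists a.
  move=> <-; rewrite mnmE; move: aA; rewrite inE => /pffun_onP[/subsetP sI _].
  by apply/eqP; apply: contraNT iI => ai; apply: sI.
move=> x /hV[y [hy hy0 hxy]].
apply: (mulfI (expf_neq0 (r * #|I|) hy0)); rewrite mulr0.
rewrite raddf_sum mulr_sumr /=.
transitivity (\sum_(a in A) v a * W a y).
  apply: eq_bigr => a aA; rewrite mevalZ mulrCA; congr (_ * _).
  rewrite mevalX (bigID (mem I)) /= [X in _ * (_ * X)]big1 ?mulr1; last first.
    move=> i iI; rewrite mnmE; move: aA; rewrite inE => /pffun_onP[/subsetP sI _].
    have -> : a i = 0; last by rewrite expr0.
    by apply/eqP; apply: contraNT iI => ai; apply: sI.
  rewrite exprM -prodr_const -big_split; apply: eq_bigr => i _ /=.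
  by rewrite mnmE -hxy exprMn mulrAC -exprD subnKC // -ltnS.
under eq_bigr => a aA do rewrite hc // mulr_sumr.
rewrite exchange_big /= big1 // => b bJ.
under eq_bigr do rewrite mulrA.
rewrite -mulr_suml hv ?mul0r //.
by rewrite inE.
Qed.

Lemma dim_le_sub N (V W : 'rV[C]_N -> Prop) D :
  (forall x, V x -> W x) -> dim_le W D -> dim_le V D.
Proof.
move=> VW hW I hI; have [p [p0 [ps pW]]] := hW I hI.
by exists p; split=> //; split=> // x /VW /pW.
Qed.

(** The product of the polynomials attached to the pieces is nonzero, involves only variables in
    [I], and vanishes on every piece. *)
Lemma dim_le_bigU N (X : finType) (V : X -> 'rV[C]_N -> Prop) D :
  (forall t, dim_le (V t) D) -> dim_le (fun x => exists t, V t x) D.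
Proof.
move=> hV I hI; have /fin_all_exists[p hp] := fun t => hV t I hI.
exists (\prod_t p t); split; [|split].
- by apply/prodf_neq0 => t _; have [] := hp t.
- move=> m mp i iI.
  have : forall m', m' \in msupp (\prod_t p t) -> m' i = 0%N; last by apply.
  elim/big_ind: _ => [m'|q q' IHq IHq' m'|t _ m' mt].
  + by rewrite msupp1 inE => /eqP ->; rewrite mnm0E.
  + by move/msuppM_le/allpairsP => [[a b] /= [aq bq ->]]; rewrite mnmDE IHq // IHq'.
  + by have [_ [ps _]] := hp t; apply: ps mt _ iI.
move=> x [t Vt]; have [_ [_ p0]] := hp t.
rewrite rmorph_prod /=; apply/eqP/prodf_eq0; exists t => //; exact/eqP/p0.
Qed.

(** * Subalgebras of truncated power series *)

Section TruncatedAlgebra.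
Context {F : fieldType}.
Implicit Types (p q : {poly F}) (S : pred nat).

Definition eqmodX (c : nat) p q : Prop := forall l, (l < c)%N -> p`_l = q`_l.

Lemma eqmodXM c p p' q q' : eqmodX c p p' -> eqmodX c q q' -> eqmodX c (p * q) (p' * q').
Proof.
move=> hp hq l lc; rewrite !coefM; apply: eq_bigr => -[i /= ltil] _.
rewrite hp ?hq //; lia.
Qed.

Definition ordmonic (s : nat) p : Prop := (forall l, (l < s)%N -> p`_l = 0) /\ p`_s = 1.

Lemma ordmonicM s t p q : ordmonic s p -> ordmonic t q -> ordmonic (s + t) (p * q).
Proof.
case=> p0 ps [q0 qt]; split=> [l ll|].
  rewrite coefM big1 // => -[i /= ltil] _.
  case: (ltnP i s) => [/p0 ->|lesi]; first by rewrite mul0r.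
  rewrite q0 ?mulr0 //; lia.
have lts : (s < (s + t).+1)%N by rewrite ltnS leq_addr.
rewrite coefM (bigD1 (Ordinal lts)) //= addKn ps qt mulr1 big1 ?addr0 //.
move=> -[i /= ltil]; rewrite -val_eqE /= => nis.
case: (ltnP i s) => [/p0 ->|lesi]; first by rewrite mul0r.
rewrite q0 ?mulr0 //; lia.
Qed.

(** For an additive submonoid these are the minimal generators: positive elements that are not the
    sum of two positive elements. *)
Definition semigroup_gen S (t : nat) : bool :=
  [&& S t, (0 < t)%N & ~~ has (fun a => S a && S (t - a)%N) (iota 1 t.-1)].

(** Strong induction: an element that is not a generator splits into two smaller ones. The boolean
    implication gives a witness for every [s], so that [xchoose] yields a total function. *)
Lemma gdec_exists S s : exists ds, S s ==> all (semigroup_gen S) ds && (sumn ds == s).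
Proof.
have [n] := ubnP s; elim: n s => // n IH s; rewrite ltnS => lesn.
have [Ss|] := boolP (S s); last by exists [::].
have [->|s0] := posnP s; first by exists [::].
have [gs|] := boolP (semigroup_gen S s); first by exists [:: s]; rewrite /= gs addn0 eqxx.
rewrite /semigroup_gen Ss s0 /= negbK => /hasP[a]; rewrite mem_iota => /andP[a1 a2] /andP[Sa Sb].
have [|da] := IH a; first by lia.
have [|db] := IH (s - a)%N; first by lia.
rewrite Sa Sb /= => /andP[hb /eqP eb] /andP[ha /eqP ea].
exists (da ++ db); rewrite all_cat ha hb sumn_cat ea eb /=; apply/eqP; lia.
Qed.

Definition gdec S s : seq nat := xchoose (gdec_exists S s).

Lemma gdecP S s : S s -> all (semigroup_gen S) (gdec S s) /\ sumn (gdec S s) = s.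
Proof. by have := xchooseP (gdec_exists S s) => /implyP h /h /andP[? /eqP]. Qed.

(** Normal form of an element of order [t]: the coefficients at larger elements of [S] are
    eliminated, and only those at larger gaps below [c] remain. *)
Definition gen_poly S (c : nat) (w : nat -> nat -> F) (t : nat) : {poly F} :=
  'X^t + \sum_(l < c | (t < l)%N && ~~ S l) w t l *: 'X^l.

(** For [s] in [S] this has order [s]; the whole basis is thus determined by the tails [w t] of the
    generators alone. *)
Definition basis_poly S c w (s : nat) : {poly F} :=
  \prod_(t <- gdec S s) gen_poly S c w t.

Lemma gen_poly_ordmonic S c w t : ordmonic t (gen_poly S c w t).
Proof.
have h l : (l <= t)%N -> (\sum_(j < c | (t < j)%N && ~~ S j) w t j *: 'X^j : {poly F})`_l = 0.
  move=> lelt; rewrite coef_sum big1 // => j /andP[ltj _].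
  by rewrite coefZ coefXn; case: eqP => [e|]; rewrite ?mulr0 //; lia.
split=> [l ltlt|]; rewrite coefD coefXn h ?addr0 ?eqxx //; last by exact: ltnW.
by case: eqP => // e; lia.
Qed.

Lemma basis_poly_ordmonic S c w s : S s -> ordmonic s (basis_poly S c w s).
Proof.
move=> Ss; have [_ e] := gdecP Ss; rewrite /basis_poly -[X in ordmonic X]e.
elim: (gdec S s) => [|t ds IH]; first by rewrite big_nil; split=> //=; rewrite coef1.
by rewrite big_cons; apply: ordmonicM => //; apply: gen_poly_ordmonic.
Qed.

(** * Bases of a subalgebra of polynomials modulo [X^c] with order set [S] *)

Section Basis.
Context (c : nat) (S : pred nat) (A : {poly F} -> Prop).
Hypothesis A_lin : forall a p q, A p -> A q -> A (a *: p + q).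
Hypothesis A_mul : forall p q, A p -> A q -> A (p * q).
Hypothesis A_one : A 1.
Hypothesis A_eqm : forall p q, eqmodX c p q -> A p -> A q.
Hypothesis A_ord : forall p s, (s < c)%N -> A p ->
  (forall l, (l < s)%N -> p`_l = 0) -> p`_s != 0 -> S s.
Hypothesis S_ord : forall s, (s < c)%N -> S s ->
  exists2 p, A p & (forall l, (l < s)%N -> p`_l = 0) /\ p`_s != 0.

(** Elimination of lowest terms: an element of order [t < c] has [t] in [S], and subtracting a
    multiple of [B t] raises its order. Nothing is left modulo [X^c] after [c] steps. *)
Lemma alg_span (B : nat -> {poly F}) :
  (forall s, (s < c)%N -> S s -> A (B s) /\ ordmonic s (B s)) ->
  forall p, A p -> exists z : nat -> F, eqmodX c p (\sum_(s < c | S s) z s *: B s).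
Proof.
move=> hB.
suff H k t p : (c - t <= k)%N -> A p -> (forall l, (l < t)%N -> p`_l = 0) ->
    exists z : nat -> F, eqmodX c p (\sum_(s < c | S s) z s *: B s).
  by move=> p Ap; apply: (H c 0%N) => //; rewrite subn0.
elim: k t p => [|k IH] t p hk Ap p0.
  exists (fun=> 0) => l lc; rewrite big1 ?coef0 ?p0 //; first by lia.
  by move=> s _; rewrite scale0r.
have [lect|ltct] := leqP c t.
  by apply: (IH t) => //; rewrite (eqP lect).
have [pt|pt] := eqVneq p`_t 0.
  apply: (IH t.+1) => // [|l]; first by lia.
  by rewrite ltnS leq_eqVlt => /predU1P[->|/p0].
have St := A_ord ltct Ap p0 pt; have [ABt [Bt0 Bt1]] := hB t ltct St.
have [||l|z hz] := IH t.+1 (- p`_t *: B t + p); first by lia.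
- exact: A_lin.
- rewrite coefD coefZ ltnS leq_eqVlt => /predU1P[->|lt]; first by rewrite Bt1 mulr1 addNr.
  by rewrite Bt0 // (p0 l) // mulr0 addr0.
exists (fun s => z s + (if s == t then p`_t else 0)) => l lc.
have -> : \sum_(s < c | S s) (z s + (if (s : nat) == t then p`_t else 0)) *: B s =
    \sum_(s < c | S s) z s *: B s + p`_t *: B t.
  under eq_bigr do rewrite scalerDl.
  rewrite big_split /= [X in _ + X](bigD1 (Ordinal ltct)) //= eqxx [X in _ + (_ + X)]big1 ?addr0 //.
  by move=> s /andP[_]; rewrite -val_eqE /= => /negPf ->; rewrite scale0r.
by rewrite coefD -hz // coefD !coefZ mulNr addrAC addNr add0r.
Qed.

(** Starting from an element of order [s], the coefficients at larger [t] in [S] are killed in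
    increasing order of [t], by multiples of elements of order [t], which do not disturb the earlier
    ones. *)
Lemma alg_reduced s : (s < c)%N -> S s ->
  exists w : nat -> F, A ('X^s + \sum_(l < c | (s < l)%N && ~~ S l) w l *: 'X^l).
Proof.
move=> ltsc Ss; have [p Ap [p0 ps]] := S_ord ltsc Ss.
have zA : A 0.
  by have := A_lin (-1) A_one A_one; rewrite scaleN1r addNr.
have scA a q : A q -> A (a *: q) by move=> Aq; rewrite -[_ *: _]addr0; apply: A_lin.
suff H k t q : (c - t <= k)%N -> (s < t)%N -> A q -> ordmonic s q ->
    (forall l, (s < l < t)%N -> S l -> q`_l = 0) ->
    exists w : nat -> F, A ('X^s + \sum_(l < c | (s < l)%N && ~~ S l) w l *: 'X^l).
  apply: (H c s.+1 ((p`_s)^-1 *: p)) => //; first by lia.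
  - exact: scA.
  - by split=> [l /p0 h|]; rewrite coefZ ?h ?mulr0 // mulVf.
  - by move=> l; lia.
elim: k t q => [|k IH] t q hk st Aq [q0 qs] hq.
  exists (fun l => q`_l); apply: A_eqm Aq => l lc.
  rewrite coefD coefXn coef_sum.
  have -> : \sum_(i < c | (s < i)%N && ~~ S i) (q`_i *: 'X^i)`_l =
      (if (s < l)%N && ~~ S l then q`_l else 0).
    case: ifP => [h|/negP h]; last first.
      rewrite big1 // => i hi; rewrite coefZ coefXn.
      by case: eqP => [e|]; rewrite ?mulr0 //; case: h; rewrite e.
    rewrite (bigD1 (Ordinal lc)) //= coefZ coefXn eqxx mulr1 big1 ?addr0 //.
    move=> i /andP[_]; rewrite -val_eqE coefZ coefXn /= eq_sym => /negPf ->; exact: mulr0.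
  case: (ltngtP l s) => [/q0 ->|sl|->] /=; rewrite ?addr0 ?add0r //.
  by case: ifPn => //; rewrite negbK => Sl; apply: hq => //; rewrite sl /=; lia.
have [lect|ltct] := leqP c t.
  by apply: (IH t q) => //; rewrite (eqP lect).
have hk' : (c - t.+1 <= k)%N by lia.
have st' : (s < t.+1)%N by lia.
have [St|nSt] := boolP (S t); last first.
  apply: (IH t.+1 q) => // l /andP[sl].
  rewrite ltnS leq_eqVlt => /predU1P[->|lt] Sl; first by rewrite Sl in nSt.
  by apply: hq => //; rewrite sl.
have [r Ar [r0 rt]] := S_ord ltct St.
apply: (IH t.+1 ((- q`_t / r`_t) *: r + q)) => //.
- exact: A_lin.
- split=> [l ls|]; rewrite coefD coefZ.
    by rewrite (r0 l) ?(q0 l) ?mulr0 ?addr0 //; lia.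
  by rewrite (r0 s) ?mulr0 ?add0r.
move=> l /andP[sl]; rewrite ltnS leq_eqVlt coefD coefZ => /predU1P[->|lt] Sl.
  by rewrite mulfVK // addNr.
by rewrite (r0 l) // mulr0 add0r hq // sl.
Qed.

(** Reduced elements are needed for the generators only, since their products along [gdec] supply
    all other orders. The vanishing clause confines [w] to the pairs counted by the effective
    weight. *)
Lemma alg_basis : exists2 w : nat -> nat -> F,
  forall t l, ~~ [&& semigroup_gen S t, (t < l < c)%N & ~~ S l] -> w t l = 0 &
  forall p, A p -> exists z : nat -> F,
    eqmodX c p (\sum_(s < c | S s) z s *: basis_poly S c w s).
Proof.
have /fin_all_exists[w0 hw0] : forall t : 'I_c, exists w : nat -> F, S t ->
    A ('X^t + \sum_(l < c | (t < l)%N && ~~ S l) w l *: 'X^l).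
  move=> t; have [St|] := boolP (S t); last by exists (fun=> 0).
  by have [w hw] := alg_reduced (ltn_ord t) St; exists w.
(* Reduced elements exist for indices below [c] only; [w] is extended by zero. *)
pose w t l := if [&& semigroup_gen S t, (t < l < c)%N & ~~ S l] then
  (if insub t is Some t' then w0 t' l else 0) else 0.
exists w => [t l /negPf hw|]; first by rewrite /w hw.
apply: alg_span => s ltsc Ss; split; last exact: basis_poly_ordmonic.
have [hg hs] := gdecP Ss; have hle : {in gdec S s, forall t, (t < c)%N}.
  move=> t tin; apply: leq_ltn_trans ltsc; rewrite -[leqRHS]hs.
  by rewrite sumnE (big_rem t) //= leq_addr.
rewrite /basis_poly big_seq; elim/big_ind: _ => // t tin.
have gt := allP hg t tin; have tc := hle t tin.
have St : S t by case/and3P: gt.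
have := hw0 (Ordinal tc) St; congr A; congr (_ + _); apply: eq_bigr => l /andP[/= tl nSl].
by rewrite /w gt tl nSl ltn_ord /= insubT.
Qed.

End Basis.
End TruncatedAlgebra.

(** * Local rings of a parametrised curve *)

Lemma loc_comp1 n e (H : 'M[C]_(n.+1, e.+1)) q : loc_comp 1 H q = 1.
Proof.
have -> : loc_comp 1 H q = (map_mpoly (@polyC C) 1).@[fun i => locform (row i H) q] by [].
by rewrite rmorph1 meval1.
Qed.

Lemma loc_compM n e (H : 'M[C]_(n.+1, e.+1)) q G G' :
  loc_comp (G * G') H q = loc_comp G H q * loc_comp G' H q.
Proof.
have E K : loc_comp K H q = (map_mpoly (@polyC C) K).@[fun i => locform (row i H) q] by [].
by rewrite !E rmorphM mevalM.
Qed.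

Lemma loc_compD n e (H : 'M[C]_(n.+1, e.+1)) q G G' :
  loc_comp (G + G') H q = loc_comp G H q + loc_comp G' H q.
Proof.
have E K : loc_comp K H q = (map_mpoly (@polyC C) K).@[fun i => locform (row i H) q] by [].
by rewrite !E rmorphD mevalD.
Qed.

Lemma loc_compX n e (H : 'M[C]_(n.+1, e.+1)) q i : loc_comp 'X_i H q = locform (row i H) q.
Proof.
have -> : loc_comp 'X_i H q = (map_mpoly (@polyC C) 'X_i).@[fun i => locform (row i H) q] by [].
by rewrite map_mpolyX mevalXU.
Qed.

Lemma loc_compZ n e (H : 'M[C]_(n.+1, e.+1)) q a G :
  loc_comp (a *: G) H q = a *: loc_comp G H q.
Proof.
have E K : loc_comp K H q = (map_mpoly (@polyC C) K).@[fun i => locform (row i H) q] by [].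
by rewrite !E map_mpolyZ mevalZ mul_polyC.
Qed.

Lemma loc_comp_sum n e (H : 'M[C]_(n.+1, e.+1)) q (I : Type) (r : seq I) (P : pred I) f :
  loc_comp (\sum_(i <- r | P i) f i) H q = \sum_(i <- r | P i) loc_comp (f i) H q.
Proof.
elim/big_rec2: _ => [|i x G _ <-]; last by rewrite loc_compD.
by have := loc_compZ H q 0 0; rewrite !scale0r.
Qed.

Lemma loc_compXn n e (H : 'M[C]_(n.+1, e.+1)) q G k :
  loc_comp (G ^+ k) H q = loc_comp G H q ^+ k.
Proof. by elim: k => [|k IH]; rewrite ?expr0 ?loc_comp1 // !exprS loc_compM IH. Qed.

Lemma locform_mulmx n m (u : 'rV[C]_n.+1) (A : 'M[C]_(n.+1, m.+1)) q :
  locform (u *m A) q = \sum_i u 0 i *: locform (row i A) q.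
Proof.
rewrite /locform; under [RHS]eq_bigr do rewrite scaler_sumr.
rewrite exchange_big /=; apply: eq_bigr => j _.
rewrite mxE rmorph_sum !mulr_suml; apply: eq_bigr => i _.
by rewrite mxE rmorphM /= -!mulrA mul_polyC.
Qed.

Lemma locform_coef0 m (v : 'rV[C]_m.+1) q : (locform v q)`_0 = bform v q.1 q.2.
Proof.
rewrite -horner_coef0 /locform /bform horner_sum; apply: eq_bigr => j _.
by rewrite !hornerE.
Qed.

Lemma ord0P (p : {poly C}) s :
  p != 0 /\ Defs.ord0 p = s <-> (forall l, (l < s)%N -> p`_l = 0) /\ p`_s != 0.
Proof.
split=> [[p0 <-]|[h ps]].
  have hp : has (fun x => x != 0) p.
    by apply/hasP; exists (lead_coef p); rewrite ?lead_coef_eq0 // lead_coefE mem_nth // prednK // size_poly_gt0.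
  split; last exact: (nth_find 0 hp).
  by move=> l ll; apply/eqP; have := before_find 0 ll; move/negbFE.
have p0 : p != 0 by apply: contraNneq ps => ->; rewrite coef0.
split=> //; have hp : has (fun x => x != 0) p.
  by apply/hasP; exists (lead_coef p); rewrite ?lead_coef_eq0 // lead_coefE mem_nth // prednK // size_poly_gt0.
case: (ltngtP (Defs.ord0 p) s) => // ll.
  by have := nth_find 0 hp; rewrite h ?eqxx.
by have := before_find 0 ll; rewrite ps.
Qed.

Lemma value_semigroupP n e (H : 'M[C]_(n.+1, e.+1)) q v :
  value_semigroup H q v <-> exists k G, [/\ G \is k.-homog,
    forall l, (l < v)%N -> (loc_comp G H q)`_l = 0 & (loc_comp G H q)`_v != 0].
Proof.
split=> [[k [G [hG /ord0P[h1 h2]]]]|[k [G [hG h1 h2]]]]; first by exists k, G.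
by exists k, G; split=> //; apply/ord0P.
Qed.

Lemma coef_ordM (F : idomainType) (p q : {poly F}) s t :
  (forall l, (l < s)%N -> p`_l = 0) -> (forall l, (l < t)%N -> q`_l = 0) ->
  (forall l, (l < s + t)%N -> (p * q)`_l = 0) /\ (p * q)`_(s + t) = p`_s * q`_t.
Proof.
move=> p0 q0; split=> [l ll|].
  rewrite coefM big1 // => -[i /= ltil] _.
  case: (ltnP i s) => [/p0 ->|lesi]; first by rewrite mul0r.
  rewrite q0 ?mulr0 //; lia.
have lts : (s < (s + t).+1)%N by rewrite ltnS leq_addr.
rewrite coefM (bigD1 (Ordinal lts)) //= addKn big1 ?addr0 //.
move=> -[i /= ltil]; rewrite -val_eqE /= => nis.
case: (ltnP i s) => [/p0 ->|lesi]; first by rewrite mul0r.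
rewrite q0 ?mulr0 //; lia.
Qed.

Lemma value_semigroup0 n e (H : 'M[C]_(n.+1, e.+1)) q : value_semigroup H q 0.
Proof.
apply/value_semigroupP; exists 0%N, 1; split=> //; first exact: dhomog1.
by rewrite loc_comp1 coef1 oner_neq0.
Qed.

Lemma value_semigroupD n e (H : 'M[C]_(n.+1, e.+1)) q v w :
  value_semigroup H q v -> value_semigroup H q w -> value_semigroup H q (v + w).
Proof.
move=> /value_semigroupP[k [G [hG G0 Gv]]] /value_semigroupP[k' [G' [hG' G0' Gv']]].
apply/value_semigroupP; exists (k + k')%N, (G * G').
have [h1 h2] := coef_ordM G0 G0'.
by rewrite loc_compM h2 mulf_neq0 //; split=> //; apply: dhomogM.
Qed.

(** Such a polynomial is coprime to [X^c], and a Bezout coefficient is the inverse. *)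
Lemma exists_inv_modX (F : fieldType) c (p : {poly F}) : p`_0 != 0 ->
  exists q, eqmodX c (p * q) 1.
Proof.
move=> p0; have : coprimep p 'X^c.
  by rewrite coprimep_expr // coprimepX /root horner_coef0.
case/Bezout_eq1_coprimepP => -[u v] /= E; exists u => l lc.
have : (u * p + v * 'X^c)`_l = (1 : {poly F})`_l by rewrite E.
by rewrite coefD coefMXn lc addr0 mulrC.
Qed.

Section LocalStructure.
Context (n d : nat) (A : 'M[C]_(n.+1, d.+1)) (q : C * C) (u : 'rV[C]_n.+1) (c : nat).
Context (S : pred nat).
Hypothesis S_val : forall v, S v <-> value_semigroup A q v.
Local Notation L := (locform (u *m A) q).
Hypothesis L0 : L`_0 != 0.

(* The image modulo [X^c] of the local ring of the curve, dehomogenised by [L]. *)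
Let loc_alg (p : {poly C}) : Prop :=
  exists k (G : {mpoly C[n.+1]}), G \is k.-homog /\ eqmodX c (loc_comp G A q) (L ^+ k * p).

Let hL : {mpoly C[n.+1]} := \sum_i u 0 i *: 'X_i.

Let hL_homog k : hL ^+ k \is k.-homog.
Proof.
have h1 : hL \is 1.-homog.
  by apply: rpred_sum => i _; apply: rpredZ; rewrite dhomogX /= mdeg1.
by have := dhomogMn k h1; rewrite mul1n.
Qed.

Let hL_comp k : loc_comp (hL ^+ k) A q = L ^+ k.
Proof.
rewrite loc_compXn loc_comp_sum locform_mulmx; congr (_ ^+ k).
by apply: eq_bigr => i _; rewrite loc_compZ loc_compX.
Qed.

Let L_pow k : (L ^+ k)`_0 != 0.
Proof. by rewrite -horner_coef0 horner_exp expf_neq0 // horner_coef0. Qed.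

Let loc_alg_ord p s : (s < c)%N -> loc_alg p ->
  (forall l, (l < s)%N -> p`_l = 0) -> p`_s != 0 -> S s.
Proof.
move=> sc [k [G [hG EG]]] p0 ps; apply/S_val/value_semigroupP; exists k, G.
have [|h1 h2] := @coef_ordM _ (L ^+ k) p 0 s _ p0; first by [].
split=> // [l ll|]; first by rewrite EG ?h1 //; apply: ltn_trans sc.
by rewrite EG // -[s]add0n h2 mulf_neq0.
Qed.

Let loc_alg_quot k G : G \is k.-homog ->
  exists2 p, loc_alg p & eqmodX c (loc_comp G A q) (L ^+ k * p).
Proof.
move=> hG; have [v hv] := exists_inv_modX c (L_pow k).
have E : eqmodX c (loc_comp G A q) (L ^+ k * (v * loc_comp G A q)).
  move=> l lc; rewrite mulrA; have := @eqmodXM _ c _ _ (loc_comp G A q) (loc_comp G A q) hv.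
  by move=> -> //; rewrite mul1r.
by exists (v * loc_comp G A q) => //; exists k, G.
Qed.

(** The quotients [G / L ^ k], with [L] a unit, form a subalgebra modulo [X^c] whose orders below
    [c] are those of [S], so [alg_basis] applies to it. The rows of [A] are [L] times the elements
    ['X_a / L]. *)
Lemma local_structure :
  exists2 w : nat -> nat -> C,
    forall t l, ~~ [&& semigroup_gen S t, (t < l < c)%N & ~~ S l] -> w t l = 0 &
    forall a, exists z : nat -> C, eqmodX c (locform (row a A) q)
      (L * \sum_(s < c | S s) z s *: basis_poly S c w s).
Proof.
have [] := @alg_basis _ c S loc_alg.
- move=> a p p' [k [G [hG EG]]] [k' [G' [hG' EG']]].
  exists (k + k')%N, (a *: (G * hL ^+ k') + G' * hL ^+ k); split.
    by apply: rpredD; [apply: rpredZ|rewrite addnC]; apply: dhomogM (hL_homog _).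
  move=> l lc; rewrite loc_compD loc_compZ !loc_compM !hL_comp coefD coefZ.
  have -> := @eqmodXM _ c _ _ (L ^+ k') (L ^+ k') EG (fun _ _ => erefl) l lc.
  have -> := @eqmodXM _ c _ _ (L ^+ k) (L ^+ k) EG' (fun _ _ => erefl) l lc.
  rewrite -coefZ -coefD; congr (nth _ (polyseq _) l); rewrite exprD mulrDr -scalerAr.
  by congr (_ *: _ + _); [rewrite mulrAC|rewrite mulrC mulrA].
- move=> p p' [k [G [hG EG]]] [k' [G' [hG' EG']]].
  exists (k + k')%N, (G * G'); split; first exact: dhomogM.
  move=> l lc; rewrite loc_compM (eqmodXM EG EG') //; congr (nth _ (polyseq _) l).
  by rewrite exprD mulrACA.
- by exists 0%N, 1; split; [exact: dhomog1|rewrite loc_comp1 expr0 mulr1].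
- move=> p p' Ep [k [G [hG EG]]]; exists k, G; split=> // l lc.
  by rewrite EG //; apply: eqmodXM Ep l lc.
- exact: loc_alg_ord.
- move=> s sc /S_val/value_semigroupP[k [G [hG G0 Gs]]].
  have [p Ap Ep] := loc_alg_quot hG; exists p => //.
  (* Since [L ^ k] is a unit, [p] has the order of the composite of [G]; each coefficient is
     compared once the lower ones are known to vanish. *)
  have p0 l : (l < s)%N -> p`_l = 0.
    have [m] := ubnP l; elim: m l => // m IH l; rewrite ltnS => lm ls.
    have [||h1 h2] := @coef_ordM _ (L ^+ k) p 0 l; first by [].
      by move=> l' ll'; apply: IH; lia.
    have := Ep l (ltn_trans ls sc); rewrite G0 // -{1}[l]add0n h2 => /eqP.
    by rewrite eq_sym mulf_eq0 (negPf (L_pow k)) => /eqP.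
  split=> //; have [|h1 h2] := @coef_ordM _ (L ^+ k) p 0 s _ p0; first by [].
  by move: Gs; rewrite (Ep s) // -{1}[s]add0n h2 mulf_eq0 negb_or => /andP[].
move=> w hw hz; exists w => // a.
have [|p Ap Ep] := @loc_alg_quot 1 'X_a.
  by rewrite dhomogX /= mdeg1.
have [z Ez] := hz p Ap; exists z => l lc; rewrite -loc_compX Ep // expr1.
exact: eqmodXM Ez l lc.
Qed.

End LocalStructure.

(** * Invariance under a change of coordinate on the source *)

(** The natural numbers stay distinct in [F], so the difference has more roots than its degree
    allows. *)
Lemma polyP_eval (F : numDomainType) (p q : {poly F}) : (forall x, p.[x] = q.[x]) -> p = q.
Proof.
move=> e; apply/eqP; rewrite -subr_eq0; apply/eqP.
apply: (@roots_geq_poly_eq0 _ _ [seq i%:R | i <- iota 0 (size (p - q))]).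
- by apply/allP => x _; rewrite /root hornerD hornerN e subrr.
- by rewrite map_inj_uniq ?iota_uniq // => i j /eqP; rewrite eqr_nat => /eqP.
- by rewrite size_map size_iota.
Qed.

Lemma meval_homogZ (n k : nat) (R : comRingType) (G : {mpoly R[n]}) (a : R) (v : 'I_n -> R) :
  G \is k.-homog -> G.@[fun i => a * v i] = a ^+ k * G.@[v].
Proof.
move=> /dhomogP hG; rewrite !mevalE mulr_sumr; apply: eq_big_seq => m /hG <-.
rewrite mulrCA; congr (_ * _); under eq_bigr do rewrite exprMn.
by rewrite big_split /= prodrXr mdegE.
Qed.

Lemma loc_comp_eval n e (G : {mpoly C[n.+1]}) (H : 'M[C]_(n.+1, e.+1)) q x :
  (loc_comp G H q).[x] = G.@[fun i => (locform (row i H) q).[x]].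
Proof.
rewrite {1}[G]mpolyE [in RHS](mpolyE G) raddf_sum loc_comp_sum horner_sum /=.
apply: eq_bigr => m _; rewrite loc_compZ mevalZ hornerZ; congr (_ * _).
rewrite mevalX.
have -> : loc_comp 'X_[m] H q =
    (map_mpoly (@polyC C) 'X_[m]).@[fun i => locform (row i H) q] by [].
rewrite map_mpolyX mevalX horner_prod; apply: eq_bigr => i _; exact: horner_exp.
Qed.

Lemma locform_eval m (v : 'rV[C]_m.+1) q x :
  (locform v q).[x] = bform v (q.1 + (cpl q).1 * x) (q.2 + (cpl q).2 * x).
Proof.
rewrite /locform /bform horner_sum; apply: eq_bigr => j _.
by rewrite !(hornerE, horner_exp).
Qed.

Lemma bform_homog m (v : 'rV[C]_m.+1) a t u : bform v (a * t) (a * u) = a ^+ m * bform v t u.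
Proof.
rewrite /bform mulr_sumr; apply: eq_bigr => j _; rewrite !exprMn.
have -> : a ^+ m = a ^+ (m - j) * a ^+ j by rewrite -exprD subnK // -ltnS.
move: (v 0 j) (a ^+ (m - j)) (a ^+ j) (t ^+ _) (u ^+ _) => x1 x2 x3 x4 x5; ring.
Qed.

Lemma bform1 (P : 'M[C]_(2, 2)) i t u : bform (row i P) t u = P i 0 * t + P i 1 * u.
Proof.
rewrite /bform !big_ord_recl big_ord0 /= !mxE expr0 expr1 mulr1 addr0 expr0 mulr1.
by congr (_ + P i _ * _); apply: val_inj.
Qed.

Definition has_order (F : nzRingType) (p : {poly F}) (v : nat) : Prop :=
  (forall l, (l < v)%N -> p`_l = 0) /\ p`_v != 0.

Lemma has_order_uniq (F : nzRingType) (p : {poly F}) v w :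
  has_order p v -> has_order p w -> v = w.
Proof.
move=> [v0 v1] [w0 w1]; case: (ltngtP v w) => // [/w0 e|/v0 e].
  by rewrite e eqxx in v1.
by rewrite e eqxx in w1.
Qed.

Lemma has_orderM (F : idomainType) (p q : {poly F}) v : p`_0 != 0 ->
  has_order (p * q) v <-> has_order q v.
Proof.
move=> p0; have key w : has_order q w -> has_order (p * q) w.
  move=> [q0 qw]; have [|h1 h2] := @coef_ordM _ p q 0 w _ q0; first by [].
  by split; rewrite // -[w]add0n h2 mulf_neq0.
split; last exact: key.
move=> pqv; have q0 : q != 0.
  by apply: contra_neq pqv.2 => ->; rewrite mulr0 coef0.
have [w qw] : exists w, has_order q w.
  have hq : exists l, q`_l != 0 by exists (size q).-1; rewrite -lead_coefE lead_coef_eq0.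
  exists (ex_minn hq); case: ex_minnP => w qw hw; split=> // l lw.
  by apply/eqP; apply: contraTT lw => /hw; rewrite leqNgt.
by rewrite (has_order_uniq pqv (key w qw)).
Qed.

(** As [W(0)] and [b] are nonzero, [b x / W(x)] is again a local parameter at 0 and [W ^ D] is a
    unit there, so the order does not change. *)
Lemma has_order_subst (F : numFieldType) (p r W : {poly F}) (b : F) (D v : nat) :
  W`_0 != 0 -> b != 0 ->
  (forall x, W.[x] != 0 -> r.[x] = W.[x] ^+ D * p.[b * x / W.[x]]) ->
  has_order r v <-> has_order p v.
Proof.
move=> W0 b0 E; pose M := size p.
(* This is [W ^ M * p(b X / W)] cleared of denominators. *)
pose t := \sum_(j < M) (p`_j * b ^+ j) *: ('X^j * W ^+ (M - j)).
have W_neq0 : W != 0 by apply: contraNneq W0 => ->; rewrite coef0.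
have ET : W ^+ M * r = W ^+ D * t.
  (* The extra factor [W] makes the identity trivial at the zeros of [W], where the hypothesis says
     nothing. *)
  apply: (mulfI W_neq0); apply: polyP_eval => x; rewrite !hornerM.
  have [->|Wx] := eqVneq W.[x] 0; first by rewrite !mul0r.
  congr (_ * _); rewrite E // !horner_exp mulrCA; congr (_ * _).
  rewrite [p.[_]]horner_coef mulr_sumr horner_sum; apply: eq_bigr => j _.
  rewrite hornerZ hornerM hornerXn horner_exp.
  have -> : W.[x] ^+ M = W.[x] ^+ (M - j) * W.[x] ^+ j by rewrite -exprD subnK // ltnW.
  rewrite !exprMn exprVn.
  have := expf_neq0 j Wx; move: (W.[x] ^+ j) (W.[x] ^+ _) (b ^+ _) (x ^+ _) => A B B' X A0.
  by field.
have tp w : has_order p w -> has_order t w.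
  move=> [p0 pw]; have coeft l (lw : (l <= w)%N) :
      t`_l = if l == w then p`_w * b ^+ w * (W ^+ (M - w))`_0 else 0.
    rewrite /t coef_sum.
    have h j : (j < M)%N -> ((p`_j * b ^+ j) *: ('X^j * W ^+ (M - j)))`_l =
        if (j == w) && (l == w) then p`_w * b ^+ w * (W ^+ (M - w))`_0 else 0.
      move=> _; rewrite coefZ coefXnM; case: (ltngtP j w) => [/p0 ->|wj|->] /=.
      - by rewrite !mul0r.
      - by rewrite (leq_ltn_trans lw wj) mulr0.
      - case: (ltngtP l w) lw => // [_ _|-> _]; first by rewrite mulr0.
        by rewrite subnn.
    have wM : (w < M)%N.
      by rewrite ltnNge; apply: contra pw => hM; rewrite nth_default.
    rewrite (bigD1 (Ordinal wM)) //= h // eqxx big1 ?addr0 //.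
    by move=> j; rewrite -val_eqE /= => /negPf jw; rewrite h // jw.
  split=> [l lw|]; first by rewrite coeft ?ltn_eqF // ltnW.
  rewrite coeft // eqxx !mulf_neq0 ?expf_neq0 //.
  by rewrite -horner_coef0 horner_exp expf_neq0 // horner_coef0.
have Wk k : (W ^+ k)`_0 != 0 by rewrite -horner_coef0 horner_exp expf_neq0 // horner_coef0.
have key w : has_order p w -> has_order r w.
  by move=> /tp tw; apply/(has_orderM _ _ (Wk M)); rewrite ET; apply/has_orderM.
split; last exact: key.
move=> rv; have p0 : p != 0.
  apply: contra_neq rv.2 => p0; suff -> : r = 0 by rewrite coef0.
  apply: (mulfI (expf_neq0 M W_neq0)); rewrite ET mulr0 /t.
  by rewrite big1 ?mulr0 // => j _; rewrite p0 coef0 mul0r scale0r.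
have [w pw] : exists w, has_order p w.
  have hq : exists l, p`_l != 0 by exists (size p).-1; rewrite -lead_coefE lead_coef_eq0.
  exists (ex_minn hq); case: ex_minnP => w qw hw; split=> // l lw.
  by apply/eqP; apply: contraTT lw => /hw; rewrite leqNgt.
by rewrite (has_order_uniq rv (key w pw)).
Qed.

(** If the determinant vanished, [(P 0 1, - P 0 0)] or [(P 1 1, - P 1 0)] would be a common zero of
    the two forms, unless both vectors vanish; then [P = 0] and every point is one. *)
Lemma base_point_free_det (P : 'M[C]_(2, 2)) : base_point_free P ->
  P 0 0 * P 1 1 - P 0 1 * P 1 0 != 0.
Proof.
move=> bpf; apply/eqP => /eqP; rewrite subr_eq0 => /eqP e.
have no_zero t u : (t, u) <> (0, 0) -> P 0 0 * t + P 0 1 * u = 0 ->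
    P 1 0 * t + P 1 1 * u = 0 -> False.
  move=> h e0 e1; have [k] := bpf t u h; rewrite bform1.
  have [->|->] : k = 0 \/ k = 1.
    by case: k => -[|[|//]] hk; [left|right]; apply: val_inj.
  by rewrite e0 eqxx.
  by rewrite e1 eqxx.
have [e1|h] := classic ((P 0 1, - P 0 0) = (0, 0)); last first.
  apply: no_zero h _ _; first by ring.
  by rewrite mulrN [P 1 1 * _]mulrC e; ring.
have [e2|h] := classic ((P 1 1, - P 1 0) = (0, 0)); last first.
  apply: no_zero h _ _; last by ring.
  by rewrite e; ring.
case: e1 => e1 /eqP; rewrite oppr_eq0 => /eqP e0.
case: e2 => e2 /eqP; rewrite oppr_eq0 => /eqP e3.
apply: (no_zero 1 0); rewrite ?e0 ?e3 ?mul0r ?mulr0 ?addr0 //.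
by case=> /eqP; rewrite oner_eq0.
Qed.

(** Normalised representatives of the points of the projective line, [f] flagging the point at
    infinity. The flag is discrete, so a point costs one parameter. *)
Definition norm_pt (f : bool) (b : C) : C * C := if f then (0, 1) else (1, b).

(** The adjugate of [P] gives a preimage [(x, y)] of a multiple of [Q]; it is then divided by [x],
    or by [y] when [x = 0]. *)
Lemma exists_norm_pt_preim (P : 'M[C]_(2, 2)) (Q : C * C) : base_point_free P -> p1pt Q ->
  exists f b a, a != 0 /\ P 0 0 * (norm_pt f b).1 + P 0 1 * (norm_pt f b).2 = a * Q.1 /\
    P 1 0 * (norm_pt f b).1 + P 1 1 * (norm_pt f b).2 = a * Q.2.
Proof.
move=> /base_point_free_det; case: Q => Q1 Q2 /=.
move: (P 0 0) (P 0 1) (P 1 0) (P 1 1) => p0 p1 p2 p3 D hQ.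
pose x := p3 * Q1 - p1 * Q2; pose y := p0 * Q2 - p2 * Q1.
have Ex : p0 * x + p1 * y = (p0 * p3 - p1 * p2) * Q1 by rewrite /x /y; ring.
have Ey : p2 * x + p3 * y = (p0 * p3 - p1 * p2) * Q2 by rewrite /x /y; ring.
move: (p0 * p3 - p1 * p2) D x y Ex Ey => D D0 x y Ex Ey.
have [x0|x0] := eqVneq x 0; last first.
  exists false, (y / x), (D / x); split; first by rewrite mulf_neq0 ?invr_eq0.
  by rewrite /= ![D / x * _]mulrAC -Ex -Ey; split; field.
have y0 : y != 0.
  apply/eqP => y0; apply: hQ; congr pair; apply: (mulfI D0).
    by rewrite -Ex x0 y0; ring.
  by rewrite -Ey x0 y0; ring.
exists true, 0, (D / y); split; first by rewrite mulf_neq0 ?invr_eq0.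
by rewrite /= ![D / y * _]mulrAC -Ex -Ey x0; split; field.
Qed.

Section Transport.
Context (n d : nat) (A H : 'M[C]_(n.+1, d.+1)) (P : 'M[C]_(2, 2)).
Hypotheses (AHP : is_composite A H P) (P_bpf : base_point_free P).

(** If [P] sends [cpl q] to [al Q + be cpl Q], then the parameter [s] at [q] corresponds to
    [be s / (a + al s)] at [Q]. Homogeneity extracts a power of [W = a + al X], and
    [has_order_subst] applies. *)
Lemma value_semigroup_subst (f : bool) (b a : C) (Q : C * C) v : p1pt Q -> a != 0 ->
  P 0 0 * (norm_pt f b).1 + P 0 1 * (norm_pt f b).2 = a * Q.1 ->
  P 1 0 * (norm_pt f b).1 + P 1 1 * (norm_pt f b).2 = a * Q.2 ->
  value_semigroup A (norm_pt f b) v <-> value_semigroup H Q v.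
Proof.
move=> hQ a0 E0 E1; set q := norm_pt f b.
have [al [be [be0 [F0 F1]]]] : exists al be, be != 0 /\
    P 0 0 * (cpl q).1 + P 0 1 * (cpl q).2 = al * Q.1 + be * (cpl Q).1 /\
    P 1 0 * (cpl q).1 + P 1 1 * (cpl q).2 = al * Q.2 + be * (cpl Q).2.
  have D0 := base_point_free_det P_bpf.
  set c0 := P 0 0 * (cpl q).1 + _; set c1 := P 1 0 * (cpl q).1 + _.
  (* Multiplicativity of the determinant: the images of the independent vectors [q] and [cpl q] are
     independent, which will force [be != 0]. *)
  have Dq : (P 0 0 * P 1 1 - P 0 1 * P 1 0) * (q.1 * (cpl q).2 - q.2 * (cpl q).1) =
      a * (Q.1 * c1 - Q.2 * c0).
    by rewrite [RHS]mulrBr ![in RHS]mulrA -E0 -E1 /c0 /c1 -/q; ring.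
  have : q.1 * (cpl q).2 - q.2 * (cpl q).1 != 0.
    by rewrite /q /norm_pt /cpl; case: (f) => /=; rewrite ?eqxx ?oner_eq0 /=;
      rewrite ?mul0r ?mulr0 ?mulr1 ?sub0r ?subr0 ?oppr_eq0 oner_eq0.
  move=> /(mulf_neq0 D0); rewrite Dq mulf_eq0 (negPf a0) /= => Q0.
  rewrite /cpl; case: (Q) hQ Q0 => Q1 Q2 /= hQ Q0.
  have [Q10|Q10] := eqVneq Q1 0; rewrite /= ?mulr1 ?mulr0 ?addr0.
    have Q20 : Q2 != 0 by apply/eqP => Q20; apply: hQ; rewrite Q10 Q20.
    exists (c1 / Q2), c0; rewrite divfK // Q10 !mulr0 mulr1 add0r addr0; split=> //.
    by apply: contraNneq Q0 => ->; rewrite Q10 mul0r mulr0 subr0.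
  exists (c0 / Q1), (c1 - c0 / Q1 * Q2); rewrite divfK //; split; last by split; ring.
  apply/eqP => e; case/eqP: Q0; rewrite -(mulr0 Q1) -e; by field.
pose W : {poly C} := a%:P + al *: 'X.
have W0 : W`_0 != 0 by rewrite coefD coefC coefZ coefX mulr0 addr0.
have key k (G : {mpoly C[n.+1]}) : G \is k.-homog ->
    has_order (loc_comp G A q) v <-> has_order (loc_comp G H Q) v.
  move=> hG; apply: (@has_order_subst _ _ _ W be (d * k) v) => // x.
  rewrite !loc_comp_eval => Wx; rewrite exprM -meval_homogZ //; apply: meval_eq => i.
  rewrite !locform_eval AHP !bform1 -bform_homog.
  have EW : W.[x] = a + al * x by rewrite !hornerE.
  congr bform; rewrite mulrDr EW.
    transitivity ((P 0 0 * q.1 + P 0 1 * q.2) + (P 0 0 * (cpl q).1 + P 0 1 * (cpl q).2) * x).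
      by ring.
    rewrite E0 F0; rewrite EW in Wx; by field.
  transitivity ((P 1 0 * q.1 + P 1 1 * q.2) + (P 1 0 * (cpl q).1 + P 1 1 * (cpl q).2) * x).
    by ring.
  rewrite E1 F1; rewrite EW in Wx; by field.
split=> /value_semigroupP[k [G [hG h1 h2]]]; apply/value_semigroupP; exists k, G.
  by have [] := (key k G hG).1 (conj h1 h2).
by have [] := (key k G hG).2 (conj h1 h2).
Qed.

End Transport.

(** * Hermite interpolation at points of the projective line *)

Lemma dvdp_XsubC_exp_comp (F : fieldType) (p : {poly F}) b c :
  (forall l, (l < c)%N -> (p \Po ('X + b%:P))`_l = 0) -> ('X - b%:P) ^+ c %| p.
Proof.
move=> h; have : 'X^c %| p \Po ('X + b%:P).
  rewrite /dvdp; apply/eqP/polyP => l; rewrite coef0.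
  have := divp_eq (p \Po ('X + b%:P)) 'X^c.
  set m := _ %% _ => E; have sm : (size m <= c)%N.
    by have := ltn_modpN0 (p \Po ('X + b%:P)) (monic_neq0 (monicXn F c)); rewrite size_polyXn ltnS.
  have [lc|cl] := ltnP l c; last by rewrite nth_default // (leq_trans sm).
  by have := h l lc; rewrite E coefD coefMXn lc add0r.
case/dvdpP => q E; apply/dvdpP; exists (q \Po ('X - b%:P)).
have := congr1 (fun r => r \Po ('X - b%:P)) E.
by rewrite comp_polyXaddC_K comp_polyM comp_Xn_poly.
Qed.

Lemma prod_XsubC_exp_dvdp (F : fieldType) (I : eqType) (s : seq I) (b : I -> F) (c : I -> nat)
    (p : {poly F}) :
  uniq s -> {in s &, injective b} -> (forall i, i \in s -> ('X - (b i)%:P) ^+ c i %| p) ->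
  \prod_(i <- s) ('X - (b i)%:P) ^+ c i %| p.
Proof.
elim: s => [|i s IH] /=; first by rewrite big_nil dvd1p.
move=> /andP[nis us] binj h; rewrite big_cons Gauss_dvdp; last first.
  apply: coprimep_expl; rewrite coprimep_sym coprimep_XsubC /root horner_prod.
  rewrite prodf_seq_neq0; apply/allP => j js /=.
  rewrite horner_exp hornerXsubC expf_neq0 // subr_eq0; apply: contraNneq nis => e.
  by rewrite (binj i j) ?mem_head // inE js orbT.
rewrite h ?mem_head //=; apply: IH => // [j k js ks|j js].
  by apply: binj; rewrite inE ?js ?ks orbT.
by apply: h; rewrite inE js orbT.
Qed.

Section Hermite.
Context (d r : nat) (f : 'I_r.+1 -> bool) (c : 'I_r.+1 -> nat).

(** The conditions of Hermite interpolation in a fixed order: [(i, l)] stands for the coefficient of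
    order [l] at the point [i]. *)
Definition jet_seq : seq ('I_r.+1 * nat) := [seq (i, l) | i <- enum 'I_r.+1, l <- iota 0 (c i)].
Definition jet_index (k : nat) : 'I_r.+1 * nat := nth (ord0, 0%N) jet_seq k.

Lemma mem_jet_seq i l : ((i, l) \in jet_seq) = (l < c i)%N.
Proof.
apply/allpairsPdep/idP => [[i' [l' [_ h [-> ->]]]]|h]; first by rewrite mem_iota in h.
by exists i, l; rewrite mem_enum mem_iota.
Qed.

Lemma size_jet_seq : size jet_seq = (\sum_i c i)%N.
Proof.
rewrite size_allpairs_dep sumnE big_map enumT; apply: eq_bigr => i _; exact: size_iota.
Qed.

Definition jet_mx (b : 'I_r.+1 -> C) : 'M[C]_d.+1 :=
  \matrix_(j, k) (locform (delta_mx 0 j : 'rV_d.+1)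
    (norm_pt (f (jet_index k).1) (b (jet_index k).1)))`_(jet_index k).2.

Lemma locform_delta (v : 'rV[C]_d.+1) q :
  locform v q = \sum_j v 0 j *: locform (delta_mx 0 j : 'rV_d.+1) q.
Proof.
rewrite -[v in LHS]mulmx1 locform_mulmx; apply: eq_bigr => j _.
by rewrite row1.
Qed.

Lemma mul_jet_mx (v : 'rV[C]_d.+1) b k : (v *m jet_mx b) 0 k =
  (locform v (norm_pt (f (jet_index k).1) (b (jet_index k).1)))`_(jet_index k).2.
Proof.
rewrite mxE locform_delta coef_sum; apply: eq_bigr => j _.
by rewrite mxE coefZ.
Qed.

Lemma locform_fin (v : 'rV[C]_d.+1) b :
  locform v (norm_pt false b) = (\poly_(j < d.+1) v 0 (inord j)) \Po ('X + b%:P).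
Proof.
rewrite poly_def raddf_sum /=; apply: eq_bigr => j _.
rewrite /cpl /= oner_eq0 /= scale0r addr0 expr1n mulr1 scale1r.
by rewrite comp_polyZ comp_Xn_poly inord_val addrC mul_polyC.
Qed.

Lemma locform_inf (v : 'rV[C]_d.+1) b (j : 'I_d.+1) :
  (locform v (norm_pt true b))`_(d - j) = v 0 j.
Proof.
rewrite /locform /cpl /= eqxx /= scale0r scale1r addr0.
rewrite coef_sum (bigD1 j) //= big1 => [|k kj].
  by rewrite expr1n mulr1 mul_polyC add0r coefZ coefXn eqxx mulr1 addr0.
rewrite expr1n mulr1 mul_polyC add0r coefZ coefXn.
case: eqP => [e|]; rewrite ?mulr0 //; case/eqP: kj; apply: val_inj => /=.
have := ltn_ord j; have := ltn_ord k; lia.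
Qed.

(** A form of degree [d] with [d + 1] zeros, counted with multiplicity, is zero. For the
    dehomogenised polynomial [p], the affine points give coprime factors and a zero at infinity
    lowers the degree. *)
Lemma jet_mx_unit b : (\sum_i c i)%N = d.+1 ->
  (forall i j, norm_pt (f i) (b i) = norm_pt (f j) (b j) -> i = j) -> jet_mx b \in unitmx.
Proof.
move=> sumc q_inj; rewrite -row_free_unit -kermx_eq0; apply/eqP/row_matrixP => i0.
rewrite row0; set v := row _ _.
have vE : v *m jet_mx b = 0 by apply/sub_kermxP/row_sub.
have jet0 i l : (l < c i)%N -> (locform v (norm_pt (f i) (b i)))`_l = 0.
  move=> lc; have il : (i, l) \in jet_seq by rewrite mem_jet_seq.
  have ltk : (index (i, l) jet_seq < d.+1)%N by rewrite -sumc -size_jet_seq index_mem.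
  have := congr1 (fun w : 'rV_d.+1 => w 0 (Ordinal ltk)) vE.
  by rewrite mul_jet_mx /jet_index /= nth_index // mxE.
pose p : {poly C} := \poly_(j < d.+1) v 0 (inord j).
have dvd i : ~~ f i -> ('X - (b i)%:P) ^+ c i %| p.
  move=> /negPf fi; apply: dvdp_XsubC_exp_comp => l lc.
  by rewrite -locform_fin -fi jet0.
(* At most one index lies at infinity, because [norm_pt true b] ignores [b]; vanishing to order
   [c i] there kills the top [c i] coefficients. *)
have size_p : (size p + \sum_(i | f i) c i <= d.+1)%N.
  have [/existsP[i fi]|/existsPn nf] := boolP [exists i, f i]; last first.
    by rewrite big1 ?addn0 ?size_poly // => i; rewrite (negPf (nf i)).
  rewrite (bigD1 i) //= big1 ?addn0; last first.
    by move=> j /andP[fj]; case/eqP; apply: q_inj; rewrite fi fj.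
  have ci : (c i <= d.+1)%N by rewrite -sumc (bigD1 i) //= leq_addr.
  rewrite -(subnK ci) leq_add2r.
  apply/leq_sizeP => j hj; rewrite coef_poly; case: ifP => // jd.
  have := jet0 i (d - j)%N; rewrite fi.
  have -> : (d - j)%N = (d - (inord j : 'I_d.+1))%N by rewrite inordK.
  by rewrite locform_inf inordK // => -> //; lia.
have p0 : p = 0.
  apply/eqP/negPn/negP => p0.
  have : \prod_(i <- [seq i <- enum 'I_r.+1 | ~~ f i]) ('X - (b i)%:P) ^+ c i %| p.
    apply: prod_XsubC_exp_dvdp; first by rewrite filter_uniq ?enum_uniq.
    - move=> i j; rewrite !mem_filter => /andP[/negPf fi _] /andP[/negPf fj _] e.
      by apply: q_inj; rewrite fi fj e.
    - by move=> i; rewrite mem_filter => /andP[fi _]; apply: dvd.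
  move/(dvdp_leq p0); rewrite big_filter big_enum_cond /=.
  have -> : size (\prod_(i | ~~ f i) ('X - (b i)%:P) ^+ c i) = (\sum_(i | ~~ f i) c i).+1.
    rewrite size_prod; last by move=> i _; rewrite expf_neq0 // polyXsubC_eq0.
    under eq_bigr do rewrite size_exp_XsubC -addn1.
    by rewrite big_split /= sum1_card -addSn addnK.
  move=> h; have := leq_trans (leq_add h (leqnn (\sum_(i | f i) c i))) size_p.
  by rewrite -sumc [X in (_ <= X)%N](bigID f) /= addnC addnS ltnn.
apply/rowP => j; have := congr1 (fun q : {poly C} => q`_j) p0.
by rewrite coef_poly ltn_ord inord_val coef0 => ->; rewrite mxE.
Qed.

End Hermite.

(** * Polynomials whose coefficients are polynomial functions of parameters *)

Section PolynomialFamilies.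
Context {F : fieldType} {T : finType}.
Implicit Types P Q : (T -> F) -> {poly F}.

Definition polyfam P : Prop := forall l, polyfun (fun y => (P y)`_l).

Lemma polyfam_ext P Q : P =1 Q -> polyfam P -> polyfam Q.
Proof. by move=> e hP l; apply: polyfun_ext (hP l) => y; rewrite e. Qed.

Lemma polyfam_const p : polyfam (fun=> p).
Proof. by move=> l; apply: polyfun_const. Qed.

Lemma polyfamC f : polyfun f -> polyfam (fun y => (f y)%:P).
Proof.
move=> hf [|l]; first by apply: polyfun_ext hf => y; rewrite coefC.
by apply: polyfun_ext (polyfun_const 0) => y; rewrite coefC.
Qed.

Lemma polyfamD P Q : polyfam P -> polyfam Q -> polyfam (fun y => P y + Q y).
Proof.
by move=> hP hQ l; apply: polyfun_ext (polyfunD (hP l) (hQ l)) => y; rewrite coefD.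
Qed.

Lemma polyfamM P Q : polyfam P -> polyfam Q -> polyfam (fun y => P y * Q y).
Proof.
move=> hP hQ l; apply: (@polyfun_ext _ _ (fun y => \sum_(i < l.+1) (P y)`_i * (Q y)`_(l - i))).
  by move=> y; rewrite coefM.
by apply: polyfun_sum => i _; apply: polyfunM.
Qed.

Lemma polyfamZ f P : polyfun f -> polyfam P -> polyfam (fun y => f y *: P y).
Proof.
move=> hf hP; apply: polyfam_ext (polyfamM (polyfamC hf) hP) => y; exact: mul_polyC.
Qed.

Lemma polyfamX P k : polyfam P -> polyfam (fun y => P y ^+ k).
Proof.
move=> hP; elim: k => [|k IH]; first exact: polyfam_const.
by apply: polyfam_ext (polyfamM hP IH) => y; rewrite exprS.
Qed.

Lemma polyfam_sum (J : Type) (s : seq J) (R : pred J) (P : J -> (T -> F) -> {poly F}) :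
  (forall j, polyfam (P j)) -> polyfam (fun y => \sum_(j <- s | R j) P j y).
Proof.
move=> hP l; apply: (@polyfun_ext _ _ (fun y => \sum_(j <- s | R j) (P j y)`_l)).
  by move=> y; rewrite coef_sum.
by apply: polyfun_sum => j _; apply: hP.
Qed.

Lemma polyfam_prod (J : Type) (s : seq J) (P : J -> (T -> F) -> {poly F}) :
  (forall j, polyfam (P j)) -> polyfam (fun y => \prod_(j <- s) P j y).
Proof.
move=> hP; elim: s => [|j s IH].
  by apply: polyfam_ext (polyfam_const 1) => y; rewrite big_nil.
by apply: polyfam_ext (polyfamM (hP j) IH) => y; rewrite big_cons.
Qed.

Lemma polyfam_basis (S : pred nat) c (w : (T -> F) -> nat -> nat -> F) s :
  (forall t l, polyfun (fun y => w y t l)) -> polyfam (fun y => basis_poly S c (w y) s).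
Proof.
move=> hw; apply: polyfam_prod => t; apply: polyfamD; first exact: polyfam_const.
apply: polyfam_sum => l; apply: polyfamZ => //; exact: polyfam_const.
Qed.

End PolynomialFamilies.

Lemma polyfam_locform (T : finType) m (v : (T -> C) -> 'rV[C]_m.+1) (f : bool)
    (b : (T -> C) -> C) :
  (forall j, polyfun (fun y => v y 0 j)) -> polyfun b ->
  polyfam (fun y => locform (v y) (norm_pt f (b y))).
Proof.
move=> hv hb; apply: polyfam_sum => j; apply: polyfamM; first apply: polyfamM.
- exact: polyfamC.
- apply: polyfamX; rewrite /cpl /norm_pt; case: f; first exact: polyfam_const.
  by rewrite /= oner_eq0; exact: polyfam_const.
apply: polyfamX; rewrite /cpl /norm_pt; case: f => /=; first exact: polyfam_const.
by rewrite oner_eq0 /=; apply: polyfamD; [exact: polyfamC|exact: polyfam_const].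
Qed.

(** * Effective weights of numerical semigroups of genus at most 8 *)

Definition gap_count (S : pred nat) (c : nat) : nat := count (predC S) (iota 0 c).

(** For [c] beyond the last gap this is the effective weight of the semigroup; a smaller [c] drops
    the pairs whose gap is at least [c]. *)
Definition eff_weight (S : pred nat) (c : nat) : nat :=
  sumn [seq if S l then 0%N else count (semigroup_gen S) (iota 0 l) | l <- iota 0 c].

Lemma eq_semigroup_gen (S S' : pred nat) : S =1 S' -> semigroup_gen S =1 semigroup_gen S'.
Proof.
move=> e t; rewrite /semigroup_gen e; congr [&& _, _ & ~~ _].
by apply: eq_has => a; rewrite !e.
Qed.

Lemma eq_eff_weight (S S' : pred nat) c : S =1 S' -> eff_weight S c = eff_weight S' c.
Proof.
move=> e; congr sumn; apply: eq_map => l; rewrite e; case: ifP => // _.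
exact/eq_count/eq_semigroup_gen.
Qed.

Lemma eff_weight_geq (S : pred nat) c c' : (c <= c')%N ->
  (forall l, (c <= l)%N -> S l) -> eff_weight S c' = eff_weight S c.
Proof.
move=> le h; rewrite /eff_weight -(subnKC le) iotaD map_cat sumn_cat add0n.
rewrite -[RHS]addn0; congr (_ + _)%N.
by rewrite sumnE big_map big1_seq // => l /andP[_]; rewrite mem_iota => /andP[cl _]; rewrite h.
Qed.

(* Membership words of the additive submonoids of [nat] on [[0, k)], with at most [dl] gaps. *)
Fixpoint semigroup_words (dl k : nat) : seq bitseq :=
  if k is k'.+1 then
    flatten [seq rcons p true ::
      (if [&& (0 < k')%N, (count negb p < dl)%N &
              ~~ has (fun a => nth true p a && nth true p (k' - a)%N) (iota 1 k'.-1)]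
       then [:: rcons p false] else [::]) | p <- semigroup_words dl k']
  else [:: [::]].

(** The inequalities are strict to leave room for the position of the singular point. The last
    clause concerns truncation at [2 * dl - 1], which is a gap exactly when the semigroup is
    symmetric. *)
Definition weight_check (dl : nat) (s : bitseq) : bool :=
  let S := nth true s in
  (count negb s == dl) ==>
  [&& (eff_weight S (2 * dl) < 2 * dl)%N, (dl <= 4)%N ==> (eff_weight S (2 * dl) < dl)%N &
      if S (2 * dl).-1 then (eff_weight S (2 * dl).-1 < 2 * dl)%N
      else (eff_weight S (2 * dl).-1 < dl)%N].

(** Words of length [2 * dl] suffice because a semigroup with [dl] gaps contains every integer from
    [2 * dl] on. *)
Lemma weight_checkP : all (fun dl => all (weight_check dl) (semigroup_words dl (2 * dl))) (iota 1 8).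
Proof. by vm_compute. Qed.

Section NumericalSemigroup.
Context (S : pred nat) (gs : seq nat).
Hypotheses (S0 : S 0%N) (SD : forall a b, S a -> S b -> S (a + b)%N).
Hypotheses (gs_uniq : uniq gs) (gsP : forall v, (v \in gs) = ~~ S v).
Local Notation dl := (size gs).

Lemma gap_count_le k : (gap_count S k <= dl)%N.
Proof.
rewrite /gap_count -size_filter; apply: uniq_leq_size; first by rewrite filter_uniq ?iota_uniq.
by move=> v; rewrite mem_filter gsP => /andP[].
Qed.

(** If [v] is a gap, then [a] or [v - a] is a gap for each [a <= v]; summing over [a] gives
    [v + 1 <= 2 * dl]. *)
Lemma semigroup_conductor v : (2 * dl <= v)%N -> S v.
Proof.
apply: contraTT => nSv; rewrite -ltnNge.
have h : {in iota 0 v.+1, forall a, (predC S a + predC S (v - a)%N >= 1)%N}.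
  move=> a; rewrite mem_iota ltnS => /andP[_ av] /=.
  have := @SD a (v - a)%N; rewrite subnKC // (negPf nSv).
  by case: (S a) => //; case: (S (v - a)%N) => // /(_ isT isT).
have e : (\sum_(a <- iota 0 v.+1) predC S (v - a) = \sum_(a <- iota 0 v.+1) predC S a)%N.
  rewrite -[iota 0 v.+1]/(index_iota 0 v.+1) big_nat_rev; apply: eq_big_nat => a /andP[_ av].
  by congr (nat_of_bool (predC S _)); lia.
have : (\sum_(a <- iota 0 v.+1) 1 <= \sum_(a <- iota 0 v.+1) (predC S a + predC S (v - a)))%N.
  by rewrite big_seq [X in (_ <= X)%N]big_seq; apply: leq_sum => a /h.
rewrite sum1_size size_iota big_split /= e.
have -> : (\sum_(a <- iota 0 v.+1) predC S a)%N = gap_count S v.+1.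
  by rewrite /gap_count -sum1_count [RHS]big_mkcond /=; apply: eq_bigr => a _; case: (S a).
have := gap_count_le v.+1; lia.
Qed.

Lemma gap_count_conductor c : (2 * dl <= c)%N -> gap_count S c = dl.
Proof.
move=> h; rewrite /gap_count -size_filter; apply/perm_size/uniq_perm => //.
  by rewrite filter_uniq ?iota_uniq.
move=> v; rewrite mem_filter mem_iota /= gsP; case Sv: (S v) => //=.
by rewrite ltnNge; apply/negP => cv; rewrite semigroup_conductor // in Sv; apply: leq_trans cv.
Qed.

(** Completeness of the enumeration: its pruning tests (0 is no gap, at most [dl] gaps, no gap is a
    sum of two elements) are all satisfied by [S]. *)
Lemma mem_semigroup_words k : mkseq S k \in semigroup_words dl k.
Proof.
elim: k => // k IH; rewrite mkseqS; apply/flattenP.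
eexists; first by apply/mapP; exists (mkseq S k).
case Sk: (S k); first by rewrite mem_head.
rewrite inE; apply/orP; right.
suff -> : [&& (0 < k)%N, (count negb (mkseq S k) < dl)%N &
   ~~ has (fun a => nth true (mkseq S k) a && nth true (mkseq S k) (k - a)%N) (iota 1 k.-1)].
  by rewrite inE.
have k0 : (0 < k)%N by case: k Sk {IH} => //; rewrite S0.
rewrite k0 /=; apply/andP; split.
  have := gap_count_le k.+1; rewrite /gap_count -addn1 iotaD count_cat /= add0n Sk addn1.
  by rewrite /mkseq count_map; apply: leq_trans; rewrite ltnS leq_eqVlt; apply/orP; left; apply/eqP/eq_count.
apply/hasPn => a; rewrite mem_iota => /andP[a1 a2].
rewrite !nth_mkseq; try lia.
apply/negP => /andP[Sa Sb]; have := SD Sa Sb; rewrite subnKC ?Sk //; lia.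
Qed.

Lemma semigroup_weight : (0 < dl)%N -> (dl <= 8)%N ->
  [/\ (eff_weight S (2 * dl) < 2 * dl)%N, (dl <= 4)%N -> (eff_weight S (2 * dl) < dl)%N,
      S (2 * dl).-1 -> gap_count S (2 * dl).-1 = dl /\ (eff_weight S (2 * dl).-1 < 2 * dl)%N &
      ~~ S (2 * dl).-1 -> gap_count S (2 * dl).-1 = dl.-1 /\ (eff_weight S (2 * dl).-1 < dl)%N].
Proof.
move=> dl0 dl8; have E : nth true (mkseq S (2 * dl)) =1 S.
  move=> v; have [lt|ge] := ltnP v (2 * dl); first by rewrite nth_mkseq.
  by rewrite nth_default ?size_mkseq // semigroup_conductor.
have := allP weight_checkP dl; rewrite mem_iota dl0 ltnS dl8 => /(_ isT) /allP.
move=> /(_ _ (mem_semigroup_words (2 * dl))); rewrite /weight_check.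
have gc : gap_count S (2 * dl) = dl by apply: gap_count_conductor.
have -> : count negb (mkseq S (2 * dl)) == dl.
  by rewrite /mkseq count_map -[X in _ == X]gc; apply/eqP/eq_count.
rewrite !(eq_eff_weight _ E) E /= => /and3P[h1 h2 h3].
have gcS : gap_count S (2 * dl) = (gap_count S (2 * dl).-1 + ~~ S (2 * dl).-1)%N.
  rewrite /gap_count -{1}(prednK (n := (2 * dl)%N)) ?muln_gt0 ?dl0 //.
  by rewrite -addn1 iotaD count_cat /= add0n addn0.
split=> // [d4|hS|/negPf hS]; first by rewrite d4 in h2.
  by rewrite hS in gcS h3; split=> //; move: gc; rewrite gcS addn0.
by rewrite hS in gcS h3; split=> //; move: gc; rewrite gcS addn1 => /(congr1 predn).
Qed.

End NumericalSemigroup.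

(** * Parametrisation of the curves with prescribed value semigroups *)

Section Stratum.
Context (n d r : nat) (f : 'I_r.+1 -> bool) (S : 'I_r.+1 -> pred nat) (c : 'I_r.+1 -> nat).
Context (m : nat).

(** The blocks hold the coefficients of [L], the positions of the points, the tails of the
    generators, and the local coordinates of all rows but row [0]. The entries that really vary are
    singled out by [par_supp]. *)
Definition param : finType :=
  ((('I_d.+1 + 'I_r.+1) + ('I_r.+1 * 'I_d.+1 * 'I_d.+1)) + ('I_n * 'I_r.+1 * 'I_d.+1))%type.
Implicit Types y : param -> C.

Definition par_L y : 'rV[C]_d.+1 := \row_j y (inl (inl (inl j))).
Definition par_pt y (i : 'I_r.+1) : C := y (inl (inl (inr i))).
Definition par_w y (i : 'I_r.+1) (t l : nat) : C :=
  if (t < l < c i)%N then y (inl (inr (i, inord t, inord l))) else 0.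
Definition par_z y (a : 'I_n) (i : 'I_r.+1) (s : nat) : C := y (inr (a, i, inord s)).

Definition par_supp : {set param} := [set x : param |
  match x with
  | inl (inl _) => true
  | inl (inr (i, t, l)) => [&& semigroup_gen (S i) t, (t < l < c i)%N & ~~ S i l]
  | inr (a, i, s) => S i s && (s < c i)%N
  end].

(** With this common denominator, the adjugate replaces the inverse of the jet matrix and the
    parametrisation stays polynomial. *)
Definition par_den y : C := \det (jet_mx d f c (par_pt y)).

Definition par_jets y (a : 'I_n) : 'rV[C]_d.+1 := \row_k
  let i := (jet_index c k).1 in
  (locform (par_L y) (norm_pt (f i) (par_pt y i)) *
   \sum_(s < c i | S i s) par_z y a i s *: basis_poly (S i) (c i) (par_w y i) s)`_(jet_index c k).2.

Definition par_row y (a : 'I_n) : 'rV[C]_d.+1 :=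
  par_jets y a *m \adj (jet_mx d f c (par_pt y)).

(* The form [L] is the combination of the rows with weights [m ^+ a]; row [0] is recovered from it. *)
Definition par_mx y : 'M[C]_(n.+1, d.+1) := \matrix_(a, j)
  if unlift ord0 a is Some a' then par_row y a' 0 j
  else par_den y * par_L y 0 j - \sum_(a' < n) m%:R ^+ a'.+1 * par_row y a' 0 j.

Definition stratum (A : 'M[C]_(n.+1, d.+1)) : Prop :=
  exists y, [/\ forall t, t \notin par_supp -> y t = 0, par_den y != 0 &
    par_den y *: A = par_mx y].

Lemma polyfun_jet_mx j k : polyfun (fun y => jet_mx d f c (par_pt y) j k).
Proof.
set i := (jet_index c k).1.
have := @polyfam_locform param d (fun=> delta_mx 0 j) (f i) (fun y => par_pt y i).
move=> /(_ (fun _ => polyfun_const _) (polyfun_var _)) /(_ (jet_index c k).2).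
by apply: polyfun_ext => y; rewrite mxE.
Qed.

Lemma polyfun_par_L j : polyfun (fun y => par_L y 0 j).
Proof. by apply: polyfun_ext (polyfun_var (inl (inl (inl j)))) => y; rewrite mxE. Qed.

Lemma polyfun_par_jets a k : polyfun (fun y => par_jets y a 0 k).
Proof.
set i := (jet_index c k).1.
have h : polyfam (fun y => locform (par_L y) (norm_pt (f i) (par_pt y i)) *
   \sum_(s < c i | S i s) par_z y a i s *: basis_poly (S i) (c i) (par_w y i) s).
  apply: polyfamM.
    by apply: polyfam_locform; [exact: polyfun_par_L|exact: (polyfun_var (inl (inl (inr i))))].
  apply: polyfam_sum => s; apply: polyfamZ; first exact: (polyfun_var (inr (a, i, inord s))).
  apply: polyfam_basis => t l; rewrite /par_w; case: (t < l < c i)%N; last exact: polyfun_const.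
  exact: (polyfun_var (inl (inr (i, inord t, inord l)))).
by apply: polyfun_ext (h (jet_index c k).2) => y; rewrite mxE.
Qed.

Lemma polyfun_par_row a j : polyfun (fun y => par_row y a 0 j).
Proof.
apply: (@polyfun_ext _ _ (fun y => \sum_k par_jets y a 0 k * (\adj (jet_mx d f c (par_pt y))) k j)).
  by move=> y; rewrite mxE.
apply: polyfun_sum => k _; apply: polyfunM; first exact: polyfun_par_jets.
by apply: polyfun_adj => j' k'; apply: polyfun_jet_mx.
Qed.

Lemma polyfun_par_den : polyfun par_den.
Proof. by apply: polyfun_det => j k; apply: polyfun_jet_mx. Qed.

Lemma dim_le_stratum (D : int) : (#|par_supp|)%:Z <= D -> dim_le (coord_set stratum) D.
Proof.
move=> hD; apply: (@dim_le_param _ _ _ param par_supp par_den (fun k y => mxvec (par_mx y) 0 k)) => //.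
- exact: polyfun_par_den.
- move=> k; case/mxvec_indexP: k => a j.
  apply: (@polyfun_ext _ _ (fun y => par_mx y a j)); first by move=> y; rewrite mxvecE.
  case ea: (unlift ord0 a) => [a'|].
    by apply: polyfun_ext (polyfun_par_row a' j) => y; rewrite [RHS]mxE ea.
  apply: (@polyfun_ext _ _ (fun y =>
     par_den y * par_L y 0 j - \sum_(a' < n) m%:R ^+ a'.+1 * par_row y a' 0 j)).
    by move=> y; rewrite [RHS]mxE ea.
  apply: polyfunD; first by apply: polyfunM; [exact: polyfun_par_den|exact: polyfun_par_L].
  apply: polyfunN; apply: polyfun_sum => a' _; apply: polyfunM; first exact: polyfun_const.
  exact: polyfun_par_row.
- move=> x [A [[y [hy y0 E]] <-]]; exists y; split=> // k.
  by rewrite -E linearZ mxE.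
Qed.

Definition stratum_dim : nat :=
  (d.+1 + \sum_i (eff_weight (S i) (c i)).+1 + n * \sum_i (c i - gap_count (S i) (c i)))%N.

Lemma sum_pred_gap (Q : pred nat) k :
  (\sum_(s < d.+1) (Q s && (s < k)))%N = (minn k d.+1 - gap_count Q (minn k d.+1))%N.
Proof.
have -> : (\sum_(s < d.+1) (Q s && (s < k)) = \sum_(s < minn k d.+1) Q s)%N.
  rewrite (big_ord_widen d.+1 (fun s => nat_of_bool (Q s))) ?geq_minr // [RHS]big_mkcond.
  apply: eq_bigr => s _; rewrite leq_min ltn_ord andbT; case: (s < k)%N; by rewrite ?andbT ?andbF.
set k' := minn _ _; rewrite -(big_mkord xpredT (fun s => nat_of_bool (Q s))).
have -> : (\sum_(0 <= s < k') Q s)%N = count Q (iota 0 k').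
  by rewrite -sum1_count big_mkcond [RHS]big_mkcond /index_iota subn0.
by rewrite -{2}(size_iota 0 k') -(count_predC Q) /gap_count addnK.
Qed.

Lemma sum_pair3 (I J K : finType) (F : I * J * K -> nat) :
  (\sum_x F x = \sum_i \sum_j \sum_k F (i, j, k))%N.
Proof.
rewrite (eq_bigr (fun x => F (x.1.1, x.1.2, x.2))); last by move=> [[i j] k].
rewrite -(pair_bigA _ (fun ij k => F (ij.1, ij.2, k))) /=.
by rewrite -(pair_bigA _ (fun i j => \sum_k F (i, j, k))%N).
Qed.

Lemma card_par_supp : (forall i, (c i <= d.+1)%N) -> #|par_supp| = stratum_dim.
Proof.
move=> cd; rewrite -sum1_card big_mkcond /= !big_sumType /=.
have Ez : (\sum_(x : 'I_n * 'I_r.+1 * 'I_d.+1) (if inr x \in par_supp then 1 else 0) =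
    n * \sum_i (c i - gap_count (S i) (c i)))%N.
  rewrite sum_pair3 -[in RHS](card_ord n) -sum_nat_const; apply: eq_bigr => a _; apply: eq_bigr => i _.
  rewrite -{1 2}(minn_idPl (cd i)) -sum_pred_gap; apply: eq_bigr => s _.
  by rewrite inE; case: ifP.
have Ew : (\sum_(x : 'I_r.+1 * 'I_d.+1 * 'I_d.+1) (if inl (inr x) \in par_supp then 1 else 0) =
    \sum_i eff_weight (S i) (c i))%N.
  rewrite sum_pair3; apply: eq_bigr => i _; rewrite exchange_big /= /eff_weight sumnE big_map.
  have iotaE k : iota 0 k = index_iota 0 k by rewrite /index_iota subn0.
  rewrite iotaE big_mkord.
  rewrite (big_ord_widen d.+1 (fun l => if S i l then 0 else count (semigroup_gen (S i)) (iota 0 l))%N) //.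
  rewrite [RHS]big_mkcond; apply: eq_bigr => l _.
  have [lc|lc] := ltnP l (c i); last by rewrite big1 // => t _; rewrite inE (ltnNge l) lc /= !andbF.
  case Sl: (S i l); first by rewrite big1 // => t _; rewrite inE Sl !andbF.
  rewrite -sum1_count [RHS]big_mkcond iotaE big_mkord.
  rewrite (big_ord_widen d.+1 (fun t => if semigroup_gen (S i) t then 1 else 0)%N); last by exact: ltnW.
  rewrite [RHS]big_mkcond; apply: eq_bigr => t _.
  by rewrite inE Sl lc /= !andbT; case: (t < l)%N; rewrite ?andbT ?andbF.
rewrite Ez Ew /stratum_dim; congr (_ + _)%N.
under [X in (X + _ + _)%N]eq_bigr do rewrite inE.
under [X in (_ + X + _)%N]eq_bigr do rewrite inE.
rewrite !sum1_card !card_ord -addnA; congr (_ + _)%N.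
under [RHS]eq_bigr do rewrite -add1n.
by rewrite big_split /= sum1_card card_ord.
Qed.

End Stratum.

Lemma eq_basis_poly (F : fieldType) (S : pred nat) c (w w' : nat -> nat -> F) s :
  (forall t l, w t l = w' t l) -> basis_poly S c w s = basis_poly S c w' s.
Proof.
move=> e; apply: eq_bigr => t _; congr (_ + _); apply: eq_bigr => l _; by rewrite e.
Qed.

Section StratumMembership.
Context (n d r : nat) (f : 'I_r.+1 -> bool) (S : 'I_r.+1 -> pred nat) (c : 'I_r.+1 -> nat).
Context (m : nat) (A : 'M[C]_(n.+1, d.+1)) (b : 'I_r.+1 -> C).
Local Notation q i := (norm_pt (f i) (b i)).
Local Notation u := (\row_(a < n.+1) m%:R ^+ a : 'rV[C]_n.+1).
Hypothesis c_sum : (\sum_i c i)%N = d.+1.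
Hypothesis q_inj : forall i j, q i = q j -> i = j.
Hypothesis S_val : forall i v, S i v <-> value_semigroup A (q i) v.
Hypothesis L_neq0 : forall i, bform (u *m A) (q i).1 (q i).2 != 0.

Let c_le i : (c i <= d.+1)%N.
Proof. by rewrite -c_sum (bigD1 i) //= leq_addr. Qed.

Let jetP (k : 'I_d.+1) : ((jet_index c k).2 < c (jet_index c k).1)%N.
Proof.
rewrite -mem_jet_seq -surjective_pairing mem_nth //.
by rewrite size_jet_seq c_sum.
Qed.

Let local_data : exists w (z : 'I_r.+1 -> 'I_n.+1 -> nat -> C),
  (forall i t l, ~~ [&& semigroup_gen (S i) t, (t < l < c i)%N & ~~ S i l] -> w i t l = 0) /\
  forall i a, eqmodX (c i) (locform (row a A) (q i))
    (locform (u *m A) (q i) * \sum_(s < c i | S i s) z i a s *: basis_poly (S i) (c i) (w i) s).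
Proof.
have L0 i : (locform (u *m A) (q i))`_0 != 0 by rewrite locform_coef0.
have /fin_all_exists2[w hw hz] := fun i => local_structure (c i) (S_val i) (L0 i).
have /fin_all_exists[z hz'] := fun i => fin_all_exists (hz i).
by exists w, z.
Qed.

(** The parameters are read off from [A] by [local_structure]. They prescribe the jets of the rows,
    and the invertible jet matrix gives the rows back. *)
Lemma mem_stratum : stratum f S c m A.
Proof.
have [w [z [hw hz]]] := local_data.
(* The values of [z] off the basis indices are arbitrary, so zero is imposed there; [w] already
   vanishes off its support. *)
pose y : param n d r -> C := fun x => match x with
  | inl (inl (inl j)) => (u *m A) 0 j
  | inl (inl (inr i)) => b i
  | inl (inr (i, t, l)) => w i t l
  | inr (a, i, s) => if S i s && (s < c i)%N then z i (lift ord0 a) s else 0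
  end.
have yL : par_L y = u *m A by apply/rowP => j; rewrite mxE.
have yw i t l : par_w c y i t l = w i t l.
  rewrite /par_w; case: ifP => [/andP[tl lc]|h]; last by rewrite hw // h andbF.
  have lt := leq_trans lc (c_le i).
  by rewrite /y !inordK //; apply: ltn_trans lt.
have Eunit : jet_mx d f c (par_pt y) \in unitmx by apply: jet_mx_unit.
have den0 : par_den f c y != 0 by rewrite -unitfE -unitmxE.
have rowE a : par_den f c y *: row (lift ord0 a) A = par_row f S c y a.
  rewrite /par_den -mul_mx_scalar -mul_mx_adj mulmxA; congr (_ *m _).
  apply/rowP => k; rewrite mul_jet_mx [RHS]mxE yL /par_pt /=.
  set i := (jet_index c k).1; have lc := jetP k; rewrite (hz i _ _ lc).
  congr (nth _ (polyseq (_ * _)) _); apply: eq_bigr => s Ss.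
  rewrite (eq_basis_poly _ _ _ (yw i)); congr (_ *: _).
  by rewrite /par_z /y inordK ?Ss ?ltn_ord //; apply: leq_trans (ltn_ord s) (c_le i).
have denA a j : par_den f c y * A (lift ord0 a) j = par_row f S c y a 0 j.
  by rewrite -rowE !mxE.
exists y; split=> //.
  case=> [[[j|i]|[[i t] l]]|[[a i] s]]; rewrite inE //=; first by move=> /hw.
  by move=> /negPf ->.
apply/matrixP => a j; rewrite [LHS]mxE [RHS]mxE.
case: unliftP => [a' ->|->]; first exact: denA.
(* Row [0] has weight [m ^ 0 = 1] in [L], so it is what remains after subtracting the other weighted
   rows. *)
rewrite yL [(u *m A) 0 j]mxE big_ord_recl mulrDr mxE expr0 mul1r mulr_sumr.
rewrite -addrA -sumrB big1 ?addr0 // => a' _.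
by rewrite mxE -denA lift0 mulrCA subrr.
Qed.

(** The jets of all rows are combinations of [L] times the local basis elements, which the right
    side counts. The jet map is injective, so [n + 1] independent rows need at least [n + 1] of
    these. *)
Lemma stratum_rank : row_free A -> (n < \sum_i (c i - gap_count (S i) (c i)))%N.
Proof.
move=> freeA; have [w [z [_ hz]]] := local_data.
pose X := [set x : 'I_r.+1 * 'I_d.+1 | S x.1 x.2 && (x.2 < c x.1)%N].
have cardX : #|X| = (\sum_i (c i - gap_count (S i) (c i)))%N.
  rewrite -sum1_card big_mkcond /=.
  rewrite (eq_bigr (fun x : 'I_r.+1 * 'I_d.+1 => nat_of_bool (S x.1 x.2 && (x.2 < c x.1)%N))); last first.
    by move=> x _; rewrite inE; case: ifP.
  rewrite -(pair_bigA _ (fun i (s : 'I_d.+1) => nat_of_bool (S i s && (s < c i)%N))) /=.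
  by apply: eq_bigr => i _; rewrite sum_pred_gap (minn_idPl (c_le i)).
pose Z := \matrix_(a < n.+1, x < #|X|) z (enum_val x).1 a (enum_val x).2.
pose B := \matrix_(x < #|X|, k < d.+1) let i := (jet_index c k).1 in
  if (enum_val x).1 == i then
    (locform (u *m A) (q i) * basis_poly (S i) (c i) (w i) (enum_val x).2)`_(jet_index c k).2
  else 0.
have E : A *m jet_mx d f c b = Z *m B.
  apply/matrixP => a k; transitivity ((row a A *m jet_mx d f c b) 0 k).
    by rewrite -row_mul [RHS]mxE.
  rewrite mul_jet_mx; set i := (jet_index c k).1; set l := (jet_index c k).2.
  rewrite (hz i a l (jetP k)) mulr_sumr coef_sum [RHS]mxE.
  pose g (x : 'I_r.+1 * 'I_d.+1) := z x.1 a x.2 * (if x.1 == i then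
    (locform (u *m A) (q i) * basis_poly (S i) (c i) (w i) x.2)`_l else 0).
  transitivity (\sum_(x in X) g x); last first.
    by rewrite big_enum_val; apply: eq_bigr => x _; rewrite !mxE.
  rewrite (eq_bigl (fun x : 'I_r.+1 * 'I_d.+1 => xpredT x.1 && (S x.1 x.2 && (x.2 < c x.1)%N))); last first.
    by move=> x; rewrite inE.
  rewrite -(pair_big_dep xpredT (fun i (s : 'I_d.+1) => S i s && (s < c i)%N) (fun i s => g (i, s))) /=.
  rewrite (bigD1 i) //= [X in _ + X]big1 ?addr0; last first.
    by move=> j ji; apply: big1 => s _; rewrite /g /= (negPf ji) mulr0.
  rewrite (big_ord_widen_cond d.+1 (S i) (fun s =>
    (locform (u *m A) (q i) * (z i a s *: basis_poly (S i) (c i) (w i) s))`_l)) //.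
  by apply: eq_bigr => s _; rewrite /g /= eqxx -scalerAr coefZ.
have := mulmx_max_rank Z B; rewrite -E.
have Eu : row_free (jet_mx d f c b) by rewrite row_free_unit; apply: jet_mx_unit.
by rewrite mxrankMfree // (eqP freeA) cardX.
Qed.

End StratumMembership.

(** * Choice of the jet orders *)

Lemma sum_nat_delta (I : finType) (i0 : I) : (\sum_i (i == i0))%N = 1%N.
Proof. by rewrite (bigD1 i0) //= eqxx big1 // => i /negPf ->. Qed.

(** If [d >= 2 g - 1], every [c i] is at least twice the number of gaps, the excess going to one
    point. If [d = 2 g - 2], one order is one less; the second alternative occurs when this omits a
    gap. *)
Lemma exists_jet_orders (r d g : nat) (S : 'I_r.+1 -> pred nat) (gs : 'I_r.+1 -> seq nat) :
  (forall i, S i 0%N) -> (forall i a b, S i a -> S i b -> S i (a + b)%N) ->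
  (forall i, uniq (gs i)) -> (forall i v, (v \in gs i) = ~~ S i v) ->
  (forall i, (0 < size (gs i))%N) -> (\sum_i size (gs i))%N = g -> (g <= 8)%N ->
  (2 * g - 2 <= d)%N ->
  exists2 c : 'I_r.+1 -> nat, (\sum_i c i)%N = d.+1 &
    ((\sum_i (c i - gap_count (S i) (c i)) = d.+1 - g)%N /\
       (\sum_i (eff_weight (S i) (c i)).+1 <= 2 * g)%N) \/
    [/\ (d = 2 * g - 2)%N, (\sum_i (c i - gap_count (S i) (c i)) = g)%N &
       (\sum_i (eff_weight (S i) (c i)).+1 <= g)%N].
Proof.
move=> S0 SD gu gP dl0 sumg g8 gd.
pose dl i := size (gs i).
have dlg i : (dl i <= g)%N by rewrite -sumg (bigD1 i) //= leq_addr.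
have W i := semigroup_weight (S0 i) (SD i) (gu i) (gP i) (dl0 i) (leq_trans (dlg i) g8).
have big_c i c : (2 * dl i <= c)%N ->
    gap_count (S i) c = dl i /\ eff_weight (S i) c = eff_weight (S i) (2 * dl i).
  move=> h; rewrite (gap_count_conductor (S0 i) (SD i) (gu i) (gP i)) //; split=> //.
  by apply: eff_weight_geq => // l; apply: (semigroup_conductor (S0 i) (SD i) (gu i) (gP i)).
have sum2 : (\sum_i 2 * dl i = 2 * g)%N by rewrite -big_distrr /= sumg.
have g0 : (0 < g)%N by apply: leq_trans (dlg ord0); apply: dl0.
have [lt|ge] := ltnP d (2 * g - 1); last first.
  pose K := (d.+1 - 2 * g)%N; pose c (i : 'I_r.+1) := (2 * dl i + (i == ord0) * K)%N.
  have sumK : (\sum_(i < r.+1) (i == ord0) * K = K)%N.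
    by rewrite -big_distrl /= sum_nat_delta mul1n.
  exists c; first by rewrite big_split /= sum2 sumK /K; lia.
  left; split.
    rewrite (eq_bigr (fun i => (dl i + (i == ord0) * K)%N)); last first.
      by move=> i _; have [|-> _] := big_c i (c i); rewrite /c ?leq_addr //; lia.
    by rewrite big_split /= sumK sumg /K; lia.
  rewrite -sum2; apply: leq_sum => i _; have [|_ ->] := big_c i (c i); first by rewrite leq_addr.
  by have [] := W i.
have dE : d = (2 * g - 2)%N by lia.
(* Shortening at a point with the most gaps leaves at most [g / 2 <= 4] gaps at each other point,
   where the sharper bound on the weight holds. *)
have [i0 _ hi0] : exists2 i0, true & forall i, (dl i <= dl i0)%N.
  by exists [arg max_(i > ord0) dl i] => //; case: arg_maxnP => // j _ hj i; apply: hj.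
pose c (i : 'I_r.+1) := (2 * dl i - (i == i0))%N.
have sumc : (\sum_i c i)%N = d.+1.
  apply/eqP; rewrite -(eqn_add2r 1) -{1}(sum_nat_delta i0) -big_split /=.
  rewrite (eq_bigr (fun i => 2 * dl i)%N); first by rewrite sum2; apply/eqP; lia.
  move=> i _; rewrite /c; have : (0 < dl i)%N := dl0 i; case: (i == i0); lia.
have ci i : i != i0 -> c i = (2 * dl i)%N by rewrite /c => /negPf ->; rewrite subn0.
have ci0 : c i0 = (2 * dl i0).-1 by rewrite /c eqxx subn1.
have [_ _ W3 W4] := W i0; rewrite -/(dl i0) -ci0 in W3 W4.
exists c => //; case S1: (S i0 (c i0)).
  have {W3}[W3 W3'] := W3 S1; left; split.
    apply/eqP; rewrite -(eqn_add2r 1) -{1}(sum_nat_delta i0) -big_split /=.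
    rewrite (eq_bigr dl); first by rewrite sumg; apply/eqP; lia.
    move=> i _; have := dl0 i; rewrite -/(dl i).
    have [->|ni] := eqVneq i i0; first by rewrite W3 ci0; lia.
    by have [|-> _] := big_c i (c i); rewrite ci //; lia.
  rewrite -sum2; apply: leq_sum => i _; have [->|ni] := eqVneq i i0; first exact: W3'.
  by rewrite ci //; have [] := W i.
have {W4}[W4 W4'] := W4 (negbT S1); right; split=> //.
  rewrite -sumg; apply: eq_bigr => i _; have := dl0 i; rewrite -/(dl i).
  have [->|ni] := eqVneq i i0; first by rewrite W4 ci0; lia.
  by have [|-> _] := big_c i (c i); rewrite ci //; lia.
rewrite -sumg; apply: leq_sum => i _; have [->|ni] := eqVneq i i0; first exact: W4'.
rewrite ci //; have [_ + _ _] := W i; apply.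
have : (dl i0 + dl i <= g)%N.
  by rewrite -sumg (bigD1 i0) //= (bigD1 i) //= addnA leq_addr.
have := hi0 i; rewrite -/(dl i); lia.
Qed.

Lemma dim_le_empty N (D : int) : dim_le (fun _ : 'rV[C]_N => False) D.
Proof.
move=> I _; exists 1; split; first exact: oner_neq0.
by split=> // m; rewrite msupp1 inE => /eqP -> i _; rewrite mnm0E.
Qed.

(** Inside a finite union, pieces whose discrete data violate [B] are empty. *)
Lemma dim_le_cond N (V : 'rV[C]_N -> Prop) (D : int) (B : bool) :
  (B -> dim_le V D) -> dim_le (fun x => B /\ V x) D.
Proof.
case: B => h; first by apply: dim_le_sub (h isT) => x [].
by apply: dim_le_sub (@dim_le_empty _ D) => x [].
Qed.

Lemma dim_leU N (V W : 'rV[C]_N -> Prop) (D : int) :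
  dim_le V D -> dim_le W D -> dim_le (fun x => V x \/ W x) D.
Proof.
move=> hV hW; apply: (@dim_le_sub _ _ (fun x => exists t : bool, if t then V x else W x)).
  by move=> x [h|h]; [exists true|exists false].
apply: dim_le_bigU => -[] //.
Qed.

(** * Multiple covers *)

Section Composites.
Context (n d e k : nat).

Definition bform_poly m (v : 'rV[C]_m.+1) (P0 P1 : {poly C}) : {poly C} :=
  \sum_(j < m.+1) v 0 j *: (P0 ^+ (m - j) * P1 ^+ j).

Lemma bform_poly_eval m (v : 'rV[C]_m.+1) P0 P1 x :
  (bform_poly v P0 P1).[x] = bform v P0.[x] P1.[x].
Proof.
rewrite horner_sum; apply: eq_bigr => j _.
by rewrite hornerZ hornerM !horner_exp mulrA.
Qed.

Lemma coef_bform_polyX m (v : 'rV[C]_m.+1) (j : 'I_m.+1) : (bform_poly v 'X 1)`_(m - j) = v 0 j.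
Proof.
rewrite coef_sum (bigD1 j) //= big1 => [|i ij].
  by rewrite expr1n mulr1 coefZ coefXn eqxx mulr1 addr0.
rewrite expr1n mulr1 coefZ coefXn; case: eqP => [E|]; rewrite ?mulr0 //.
case/eqP: ij; apply: val_inj => /=; have := ltn_ord j; have := ltn_ord i; lia.
Qed.

Lemma bform_eq0 m (v : 'rV[C]_m.+1) : (forall t u, bform v t u = 0) -> v = 0.
Proof.
move=> h; apply/rowP => j; rewrite -coef_bform_polyX [RHS]mxE.
have -> : bform_poly v 'X 1 = 0 by apply: polyP_eval => x; rewrite bform_poly_eval h horner0.
exact: coef0.
Qed.

Lemma bform_mulmx m (v : 'rV[C]_n.+1) (A : 'M[C]_(n.+1, m.+1)) t u :
  bform (v *m A) t u = \sum_i v 0 i * bform (row i A) t u.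
Proof.
rewrite /bform; under [RHS]eq_bigr do rewrite mulr_sumr.
rewrite exchange_big; apply: eq_bigr => j _; rewrite mxE !mulr_suml.
by apply: eq_bigr => i _; rewrite !mxE !mulrA.
Qed.

(** A linear relation among the forms of [H] pulls back to the same relation among those of [A];
    hence [H] has rank [n + 1], which is at most its number [e + 1] of columns. *)
Lemma composite_row_free (A : 'M[C]_(n.+1, d.+1)) (H : 'M[C]_(n.+1, e.+1)) (P : 'M[C]_(2, k.+1)) :
  is_composite A H P -> row_free A -> (n <= e)%N.
Proof.
move=> AHP freeA; have freeH : row_free H.
  rewrite -kermx_eq0; apply/eqP/row_matrixP => i0; rewrite row0; set v := row _ _.
  have vH : v *m H = 0 by apply/sub_kermxP/row_sub.
  apply: (row_free_inj freeA); rewrite mul0mx; apply: bform_eq0 => t u.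
  rewrite bform_mulmx; under eq_bigr do rewrite AHP.
  by rewrite -bform_mulmx vH /bform big1 // => j _; rewrite mxE !mul0r.
by rewrite -ltnS -(eqP freeH) rank_leq_col.
Qed.

Definition cover_param : finType := ('I_n.+1 * 'I_e.+1 + 'I_2 * 'I_k.+1)%type.

(** The coefficients of a composite are polynomials in those of its factors, read off on the affine
    line [u = 1]; the denominator is 1. *)
Lemma dim_le_composite (D : int) : (n.+1 * e.+1 + 2 * k.+1)%:Z <= D ->
  dim_le (coord_set (fun A : 'M[C]_(n.+1, d.+1) =>
    exists (H : 'M[C]_(n.+1, e.+1)) (P : 'M[C]_(2, k.+1)), is_composite A H P)) D.
Proof.
move=> hD.
pose HH (y : cover_param -> C) : 'M[C]_(n.+1, e.+1) := \matrix_(i, j) y (inl (i, j)).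
pose PP (y : cover_param -> C) : 'M[C]_(2, k.+1) := \matrix_(i, j) y (inr (i, j)).
pose comp i (y : cover_param -> C) := bform_poly (row i (HH y))
  (bform_poly (row 0 (PP y)) 'X 1) (bform_poly (row 1 (PP y)) 'X 1).
pose F (y : cover_param -> C) : 'M[C]_(n.+1, d.+1) := \matrix_(i, j) (comp i y)`_(d - j).
have hform m (v : (cover_param -> C) -> 'rV[C]_m.+1) P0 P1 :
    (forall j, polyfun (fun y => v y 0 j)) -> polyfam P0 -> polyfam P1 ->
    polyfam (fun y => bform_poly (v y) (P0 y) (P1 y)).
  move=> hv h0 h1; apply: polyfam_sum => j; apply: polyfamZ => //.
  by apply: polyfamM; apply: polyfamX.
have hcomp i : polyfam (comp i).
  have hP a : polyfam (fun y => bform_poly (row a (PP y)) 'X 1).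
    apply: hform; try exact: polyfam_const.
    by move=> j; apply: polyfun_ext (polyfun_var (inr (a, j))) => y; rewrite !mxE.
  apply: hform => // j.
  by apply: polyfun_ext (polyfun_var (inl (i, j))) => y; rewrite !mxE.
apply: (@dim_le_param _ _ _ cover_param [set: _] (fun=> 1) (fun k y => mxvec (F y) 0 k)).
- by rewrite cardsT card_sum !card_prod !card_ord.
- exact: polyfun_const.
- move=> x; case/mxvec_indexP: x => i j.
  by apply: polyfun_ext (hcomp i (d - j)%N) => y; rewrite mxvecE mxE.
move=> x [A [[H [P AHP]] <-]].
exists (fun t => match t with inl (i, j) => H i j | inr (i, j) => P i j end).
split=> [t||x0]; [by rewrite inE|exact: oner_neq0|].
case/mxvec_indexP: x0 => i j; rewrite mul1r !mxvecE [RHS]mxE.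
set y := (fun t => _).
have -> : comp i y = bform_poly (row i A) 'X 1.
  apply: polyP_eval => z; rewrite !bform_poly_eval AHP hornerX hornerC.
  have -> : HH y = H by apply/matrixP => a b; rewrite mxE.
  by have -> : PP y = P by apply/matrixP => a b; rewrite mxE.
by rewrite coef_bform_polyX mxE.
Qed.

End Composites.

(** * The codimension bound *)

(** Points with delta invariant 0 are discarded. Each remaining one contributes at least 1 to [g],
    so there are at most [g] of them. *)
Lemma genus_points n e (H : 'M[C]_(n.+1, e.+1)) g : (0 < g)%N -> genus_sum_delta H g ->
  exists r (Q : 'I_r.+1 -> C * C) (gs : 'I_r.+1 -> seq nat),
    [/\ (r < g)%N, forall i, p1pt (Q i), forall i j, p1eq (Q i) (Q j) -> i = j,
        forall i, [/\ uniq (gs i), (0 < size (gs i))%N &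
          forall v, v \in gs i <-> ~ value_semigroup H (Q i) v] &
        (\sum_i size (gs i))%N = g].
Proof.
move=> g0 [qs [cs [sz [sumcs [hpt [hinj [hdl _]]]]]]].
pose s := [seq j <- iota 0 (size qs) | (0 < nth 0 cs j)%N].
have sums : (\sum_(j <- s) nth 0 cs j)%N = g.
  rewrite big_filter -sumcs sumnE [RHS](big_nth 0%N) -sz /index_iota subn0 [LHS]big_mkcond.
  by apply: eq_bigr => j _; case: posnP.
have s_lt j : j \in s -> (j < size qs)%N by rewrite mem_filter mem_iota => /and3P[].
have s_pos j : j \in s -> (0 < nth 0 cs j)%N by rewrite mem_filter => /andP[].
have s_uniq : uniq s by rewrite filter_uniq ?iota_uniq.
have size_s : (size s <= g)%N.
  rewrite -sums -sum1_size big_seq [X in (_ <= X)%N]big_seq.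
  by apply: leq_sum => j /s_pos.
have s_gt0 : (0 < size s)%N.
  by rewrite lt0n size_eq0; apply: contraTneq g0 => s0; rewrite -sums s0 big_nil.
exists (size s).-1; set r := (size s).-1; have rE : r.+1 = size s by rewrite prednK.
have mems (i : 'I_r.+1) : nth 0%N s i \in s by rewrite mem_nth // -rE.
have /fin_all_exists[gs hgs] := fun i : 'I_r.+1 => hdl _ (s_lt _ (mems i)).
exists (fun i => nth (0, 0) qs (nth 0%N s i)), gs; split.
- by rewrite rE.
- by move=> i; apply/hpt/s_lt.
- move=> i j /(hinj _ _ (s_lt _ (mems i)) (s_lt _ (mems j))) /eqP.
  by rewrite nth_uniq // -?rE // => /eqP /val_inj.
- by move=> i; have [ui [si vi]] := hgs i; split=> //; rewrite si; apply: s_pos.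
rewrite -sums (big_nth 0%N) -rE big_mkord; apply: eq_bigr => i _.
by have [_ [-> _]] := hgs i.
Qed.

(** Each vector is read as a nonzero polynomial evaluated at [m]; the product of these has fewer
    roots than there are candidates. The finite range of [m] permits a finite union later. *)
Lemma exists_common_nonzero (r n : nat) (p : 'I_r.+1 -> 'rV[C]_n.+1) :
  (forall i, p i != 0) ->
  exists m : 'I_(r.+1 * n.+1).+1, forall i, \sum_(a < n.+1) m%:R ^+ a * p i 0 a != 0.
Proof.
move=> p0; pose F i : {poly C} := rVpoly (p i).
have F0 i : F i != 0.
  by apply: contraNneq (p0 i) => e; rewrite -(rVpolyK (p i)) -/(F i) e linear0.
have FE i x : (F i).[x] = \sum_(a < n.+1) x ^+ a * p i 0 a.
  rewrite /F horner_poly; apply: eq_bigr => a _; rewrite mulrC; congr (_ * _).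
  by case: insubP => [a' _ /val_inj ->|]; rewrite ?ltn_ord.
apply: NNPP => H.
have : \prod_i F i == 0.
  apply/eqP/(@roots_geq_poly_eq0 _ _ [seq (k : nat)%:R | k <- iota 0 (r.+1 * n.+1).+1]).
  - apply/allP => x /mapP[k]; rewrite mem_iota /= add0n => kM ->.
    rewrite /root horner_prod; apply: contraT => /prodf_neq0 h.
    by case: H; exists (Ordinal kM) => i; rewrite -FE; apply: h.
  - by rewrite map_inj_uniq ?iota_uniq // => i j /eqP; rewrite eqr_nat => /eqP.
  - rewrite size_map size_iota; apply: leq_trans (size_prod_leq _ _) _.
    apply: leq_trans (leq_subr _ _) _; rewrite ltnS.
    rewrite -[X in (_ <= X * _)%N](card_ord r.+1) -sum_nat_const.
    by apply: leq_sum => i _; apply: size_poly.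
by case/prodf_eq0 => i _; rewrite (negPf (F0 i)).
Qed.

(** All discrete data range over finite types: at most 8 points, and 16 bits for a semigroup with at
    most 8 gaps. The dimension inequality is included because its proof uses the independence of the
    rows of [A]. *)
Definition birational_stratum (n d g : nat) (A : 'M[C]_(n.+1, d.+1)) : Prop :=
  exists (r : 'I_8) (f : {ffun 'I_r.+1 -> bool}) (S : {ffun 'I_r.+1 -> 16.-tuple bool})
    (c : {ffun 'I_r.+1 -> 'I_d.+2}) (m : 'I_(r.+1 * n.+1).+1),
    [&& [forall i, c i <= d.+1] &
      stratum_dim n d (fun i => nth true (S i)) (fun i => c i) + (n - 2) * g <= n.+1 * d.+1]%N /\
    stratum f (fun i => nth true (S i)) (fun i => c i) m A.

(** Here [P] is a coordinate change, so [A] has at the preimages of the singular points the value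
    semigroups of [H]. It remains to choose jet orders and [L], and to count. *)
Lemma birational_in_stratum n d g (A H : 'M[C]_(n.+1, d.+1)) (P : 'M[C]_(2, 2)) :
  (1 < n)%N -> (0 < g)%N -> (g <= 8)%N -> (2 * g - 2 <= d)%N ->
  base_point_free A -> row_free A -> base_point_free P -> is_composite A H P ->
  genus_sum_delta H g -> birational_stratum g A.
Proof.
move=> n1 g0 g8 gd bpfA freeA bpfP AHP /(genus_points g0).
case=> r [Q [gs [rg hQ Qinj hgs sumg]]].
have /fin_all_exists[f hf] := fun i => exists_norm_pt_preim bpfP (hQ i).
have /fin_all_exists[b hb] := hf; have /fin_all_exists[a ha] := hb.
pose q i := norm_pt (f i) (b i).
have valE i v : value_semigroup A (q i) v <-> value_semigroup H (Q i) v.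
  by have [a0 [e0 e1]] := ha i; apply: (value_semigroup_subst AHP bpfP _ (hQ i) a0 e0 e1).
have q_inj i j : q i = q j -> i = j.
  move=> e; apply: Qinj; have [ai0 [i1 i2]] := ha i; have [aj0 [j1 j2]] := ha j.
  rewrite -/(q i) in i1 i2; rewrite -/(q j) -e i1 in j1; rewrite -/(q j) -e i2 in j2.
  rewrite /p1eq; apply: (mulfI aj0); rewrite [LHS]mulrCA -j2 [RHS]mulrA -j1.
  by rewrite mulrCA mulrA.
pose S i v := v \notin gs i.
have SP i v : S i v <-> value_semigroup A (q i) v.
  have [_ _ h] := hgs i; rewrite valE; split=> [/negP nv|vv].
    by apply: NNPP => /h.
  by apply/negP => /h.
have S0 i : S i 0%N by apply/SP; apply: value_semigroup0.
have SD i x y : S i x -> S i y -> S i (x + y)%N.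
  by move=> /SP hx /SP hy; apply/SP; apply: value_semigroupD.
have gu i : uniq (gs i) by have [] := hgs i.
have gp i : (0 < size (gs i))%N by have [] := hgs i.
have gP i v : (v \in gs i) = ~~ S i v by rewrite negbK.
have [c sumc hc] := exists_jet_orders S0 SD gu gP gp sumg g8 gd.
have [|m hm] := @exists_common_nonzero r n (fun i => \row_a bform (row a A) (q i).1 (q i).2).
  move=> i; have [|a0 ha0] := bpfA (q i).1 (q i).2.
    rewrite /p1pt /q /norm_pt; case: (f i) => /= -[] => [/eqP|/eqP + _];
      by rewrite oner_eq0.
  by apply/eqP => /rowP/(_ a0); rewrite !mxE => e; rewrite e eqxx in ha0.
have L0 i : bform ((\row_(a < n.+1) m%:R ^+ a) *m A) (q i).1 (q i).2 != 0.
  rewrite bform_mulmx; have := hm i; congr (_ != _); apply: eq_bigr => a' _.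
  by rewrite !mxE.
(* All gaps lie below 16, so sixteen bits with default [true] encode [S i] exactly. *)
pose T := [ffun i => [tuple S i k | k < 16]].
have TE i v : nth true (T i) v = S i v.
  rewrite ffunE; have [v16|v16] := ltnP v 16.
    by rewrite -[v]/(val (Ordinal v16)) -tnth_nth tnth_mktuple.
  rewrite nth_default ?size_tuple //; apply/esym.
  apply: (semigroup_conductor (S0 i) (SD i) (gu i) (gP i)); apply: leq_trans v16.
  by rewrite (@leq_mul2l 2 _ 8); apply: leq_trans g8; rewrite -sumg (bigD1 i) //= leq_addr.
have cd i : (c i < d.+2)%N by rewrite ltnS -sumc (bigD1 i) //= leq_addr.
have r8 : (r < 8)%N by apply: leq_trans g8.
pose c' : {ffun 'I_r.+1 -> 'I_d.+2} := [ffun i => Ordinal (cd i)].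
have c'E i : c' i = c i :> nat by rewrite ffunE.
have TP i v : nth true (T i) v <-> value_semigroup A (norm_pt (f i) (b i)) v.
  by rewrite TE; apply: SP.
have sumc' : (\sum_i c' i)%N = d.+1 by rewrite -[RHS]sumc; apply: eq_bigr => i _; exact: c'E.
have ewE i : eff_weight (nth true (T i)) (c' i) = eff_weight (S i) (c i).
  by rewrite c'E; apply: eq_eff_weight => v; apply: TE.
have gcE i : gap_count (nth true (T i)) (c' i) = gap_count (S i) (c i).
  by rewrite c'E; apply: eq_count => v /=; rewrite TE.
pose f' := [ffun i => f i]; have fE i : f' i = f i by rewrite ffunE.
have rk : (n < \sum_i (c i - gap_count (S i) (c i)))%N.
  exact: (stratum_rank sumc q_inj SP L0).
have hdim : (stratum_dim n d (fun i : 'I_r.+1 => nth true (T i)) (fun i => c' i) +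
    (n - 2) * g <= n.+1 * d.+1)%N.
  rewrite /stratum_dim.
  have -> : (\sum_i (eff_weight (nth true (T i)) (c' i)).+1 = \sum_i (eff_weight (S i) (c i)).+1)%N.
    by apply: eq_bigr => i _; rewrite ewE.
  have -> : (\sum_i (c' i - gap_count (nth true (T i)) (c' i)) =
             \sum_i (c i - gap_count (S i) (c i)))%N.
    by apply: eq_bigr => i _; rewrite gcE c'E.
  (* In the first case [2 g] parameters for the points give exactly [(n + 1) (d + 1)]. In the
     second, with [d = 2 g - 2], the inequality reduces to [n <= g], which the rank bound
     supplies. *)
  case: hc rk => [[-> hw] _|[dE -> hw] ng].
    have : (g <= d.+1)%N by lia.
    move: (\sum_i _)%N hw => w hw gd1; nia.
  move: (\sum_i _)%N hw => w hw; subst d; nia.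
exists (Ordinal r8), f', T, c', m; split.
  by rewrite hdim andbT; apply/forallP => i; rewrite c'E -ltnS.
apply: (@mem_stratum _ _ _ _ _ _ _ A b) => // [i j|i v|i]; rewrite !fE.
- exact: q_inj.
- exact: TP.
- exact: L0.
Qed.

Lemma dim_le_birational_stratum n d g (D : int) :
  (1 < n)%N -> D = (n.+1 * d.+1)%:Z - (n%:Z - 2) * g%:Z ->
  dim_le (coord_set (@birational_stratum n d g)) D.
Proof.
move=> n1 DE.
apply: (@dim_le_sub _ _ (fun x => exists (r : 'I_8) (f : {ffun 'I_r.+1 -> bool})
    (S : {ffun 'I_r.+1 -> 16.-tuple bool})
    (c : {ffun 'I_r.+1 -> 'I_d.+2}) (m : 'I_(r.+1 * n.+1).+1),
    [&& [forall i, c i <= d.+1] &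
      stratum_dim n d (fun i => nth true (S i)) (fun i => c i) + (n - 2) * g <= n.+1 * d.+1]%N /\
    coord_set (stratum (n := n) (d := d) f (fun i => nth true (S i)) (fun i => c i) m) x)).
  move=> x [A [[r [f [S [c [m [h hA]]]]]] <-]]; exists r, f, S, c, m; split=> //.
  by exists A.
do 5![apply: dim_le_bigU => ?].
apply: dim_le_cond => /andP[/forallP hc hd]; apply: dim_le_stratum.
rewrite card_par_supp // DE; move: (stratum_dim _ _ _ _) hd => k.
have -> : n = (n - 2).+2 by lia.
move: (n - 2)%N => p; rewrite subSS subSS subn0 => hd; lia.
Qed.

(** After doubling, [g] is eliminated by [2 g <= d + 2]; the substitutions [d = e k] and [e = n + p]
    leave a polynomial inequality in natural numbers. *)
Lemma multiple_cover_bound (n d e k g : nat) : (2 < n)%N -> (n <= e)%N -> (1 < k)%N ->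
  (e * k = d)%N -> (2 * g - 2 <= d)%N ->
  (n.+1 * e.+1 + 2 * k.+1 + (n - 2) * g <= n.+1 * d.+1)%N.
Proof.
case: n => [|[|n]] // n0; case: k => [|[|k]] // ne _ dE gd; rewrite subSS subSS subn0.
have [p eE] : exists p, e = (n.+2 + p)%N by exists (e - n.+2)%N; rewrite subnKC.
have hg : (2 * (n * g) <= n * (d + 2))%N by rewrite mulnCA leq_mul2l; lia.
suff : (2 * (n.+3 * e.+1 + 2 * k.+3) + n * (d + 2) <= 2 * (n.+3 * d.+1))%N by lia.
by rewrite -dE eE; nia.
Qed.

(* cod(V, M^n_d) >= (n-2) g, with dim M^n_d = (n+1)(d+1). *)
Theorem theorem1p1 (n d g : nat) :
  (1 <= n)%nat -> (1 <= d)%nat -> (0 < g)%nat -> (g <= 8)%nat ->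
  (maxn n (2 * g - 2) <= d)%nat ->
  dim_le (coord_set (@Vlocus n d g))
    ((n.+1 * d.+1)%:Z - (n%:Z - 2) * g%:Z).
Proof.
move=> n0 d0 g0 g8; rewrite geq_max => /andP[nd gd].
(* For [n <= 2] the bound is at least the number of coordinates, so no set [I] exceeds it. *)
have [n2|n2] := leqP n 2.
  move=> I hI; have := max_card (mem I); rewrite card_ord => hI'.
  have hg : (n%:Z - 2) * g%:Z <= 0 by case: n n0 n2 {nd I hI hI'} => [|[|[|]]] //; lia.
  exfalso; move: hI hI' hg; rewrite -[#|mem I|]/(#|I|).
  move: (n.+1 * d.+1)%N #|I| (_ * g%:Z) => a b c; lia.
set D := _ - _.
(* Both degrees divide [d], hence are at most [d], and the multiple covers lie in a finite union. *)
pose cover (x : 'rV[C]_(n.+1 * d.+1)) := exists e k : 'I_d.+1,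
  [&& n <= e, 1 < k & e * k == d]%N /\
  coord_set (fun A : 'M[C]_(n.+1, d.+1) =>
    exists (H : 'M[C]_(n.+1, e.+1)) (P : 'M[C]_(2, k.+1)), is_composite A H P) x.
apply: (@dim_le_sub _ _ (fun x => coord_set (@birational_stratum n d g) x \/ cover x)).
  move=> x [A [[[bpfA freeA] [e [k [H [P [e0 [k0 [ek [bpfH [bpfP [AHP [_ hg]]]]]]]]]]]] <-]].
  have ne := composite_row_free AHP freeA.
  have [k1|k1] := leqP k 1.
    have {k0 k1} k1 : k = 1%N by apply/eqP; rewrite eqn_leq k1.
    subst k; rewrite muln1 in ek; subst e.
    by left; exists A; split=> //; apply: (birational_in_stratum (ltnW n2) g0 g8 gd bpfA freeA bpfP AHP).
  have ed : (e < d.+1)%N by rewrite ltnS -ek leq_pmulr.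
  have kd : (k < d.+1)%N by rewrite ltnS -ek leq_pmull.
  right; exists (Ordinal ed), (Ordinal kd); split; first by rewrite /= ne k1 ek eqxx.
  by exists A; split=> //; exists H, P.
apply: dim_leU; first by apply: dim_le_birational_stratum => //; apply: ltnW.
do 2![apply: dim_le_bigU => ?].
apply: dim_le_cond => /and3P[ne k1 /eqP ek]; apply: dim_le_composite.
have := multiple_cover_bound n2 ne k1 ek gd; rewrite /D.
have {1}-> : n%:Z - 2 = (n - 2)%N%:Z by lia.
lia.
Qed.
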